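(* Let $\alpha,\beta\in\mathbb{R}$. The mean-square dichotomy spectrum $\Sigma$ of the linear mean-square random dynamical system $\Phi$ generated by the scalar linear mean-field stochastic differential equation $$\mathrm{d}Z_t=\big(\alpha Z_t+\beta\,\mathbb{E}Z_t\big)\,\mathrm{d}t+Z_t\,\mathrm{d}W_t$$ is given by $$\Sigma=\begin{cases}\{\alpha+1/2\}\cup\{\alpha+\beta\}&\text{if }\beta>1/2,\\ \{\alpha+1/2\}&\text{if }\beta\le 1/2.\end{cases}$$
   Context: Let $\{W_t\}_{t\in\mathbb{R}}$ be a two-sided scalar Wiener process on a complete probability space $(\Omega,\mathcal{F},\mathbb{P})$, and let $\{\mathcal{F}_t\}_{t\in\mathbb{R}}$ be its natural filtration ($\mathcal{F}_t$ is generated by the increments $W_u-W_v$, $v\le u\le t$, and the $\mathbb{P}$-null sets). Put $\mathfrak{X}_t:=L^2(\Omega,\mathcal{F}_t;\mathbb{R})$ with norm $\|X\|_{\rm ms}:=\sqrt{\mathbb{E}|X|^2}$. The linear mean-square random dynamical system (MS-RDS) generated by the equation: for $Z_s\in\mathfrak{X}_s$ and $t\ge s$, $\Phi_{t,s}Z_s:=Z_t\in\mathfrak{X}_t$, where $\{Z_t\}_{t\ge s}$ is the unique solution with initial value $Z_s$ at time $s$, i.e. $Z_t=Z_s+\int_s^t(\alpha Z_u+\beta\mathbb{E}Z_u)\,\mathrm{d}u+\int_s^tZ_u\,\mathrm{d}W_u$ (Itô integral). Each $\Phi_{t,s}:\mathfrak{X}_s\to\mathfrak{X}_t$ is a bounded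 linear operator. Exponential dichotomy: for $\gamma\in\mathbb{R}$, $\Phi$ admits an exponential dichotomy with growth rate $\gamma$ if there exist constants $K,\kappa>0$ and a time-dependent decomposition into linear subspaces $\mathfrak{X}_t=U_\gamma(t)\oplus S_\gamma(t)$, $t\in\mathbb{R}$, such that $\|\Phi_{t,s}X_s\|_{\rm ms}\le Ke^{(\gamma-\kappa)(t-s)}\|X_s\|_{\rm ms}$ for $X_s\in S_\gamma(s)$, $t\ge s$, and $\|\Phi_{t,s}X_s\|_{\rm ms}\ge\frac1Ke^{(\gamma+\kappa)(t-s)}\|X_s\|_{\rm ms}$ for $X_s\in U_\gamma(s)$, $t\ge s$. The mean-square dichotomy spectrum is $\Sigma:=\{\gamma\in\mathbb{R}:\Phi\text{ has no exponential dichotomy with growth rate }\gamma\}$. *)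

(* Defs.v *)
From mathcomp Require Import all_boot all_order all_algebra.
From mathcomp Require Import all_classical all_reals all_analysis.

Set Implicit Arguments.
Unset Strict Implicit.
Unset Printing Implicit Defensive.

Import Order.TTheory GRing.Theory Num.Theory.
Import numFieldNormedType.Exports.

Local Open Scope classical_set_scope.
Local Open Scope ring_scope.

Definition increment (R : realType) (d : measure_display)
    (Omega : measurableType d) (P : probability Omega R)
    (W : R -> {RV P >-> R}) (s t : R) (w : Omega) : R := W t w - W s w.

(* The second argument of [normal_prob] is the standard deviation. Independence
   of the increments is mutual independence over every finite chain of times. *)
Definition two_sided_wiener (R : realType) (d : measure_display)
    (Omega : measurableType d) (P : probability Omega R)
    (W : R -> {RV P >-> R}) : Prop :=
  [/\ {ae P, forall w, W 0 w = 0},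
      {ae P, forall w, continuous (fun t : R => W t w)},
      (forall (s t : R) (B : set R), s < t -> measurable B ->
         P (increment W s t @^-1` B) = normal_prob 0 (Num.sqrt (t - s)) B) &
      (forall (n : nat) (t : nat -> R) (B : nat -> set R),
         (forall i, (i < n)%N -> t i <= t i.+1) ->
         (forall i, (i < n)%N -> measurable (B i)) ->
         P (\bigcap_(i < n) (increment W (t i) (t i.+1) @^-1` B i)) =
         (\prod_(i < n) P (increment W (t i) (t i.+1) @^-1` B i))%E)].

Definition wiener_filtration (R : realType) (d : measure_display)
    (Omega : measurableType d) (P : probability Omega R)
    (W : R -> {RV P >-> R}) (t : R) : set_system Omega :=
  <<s [set A | exists v u (B : set R),
         [/\ v <= u, u <= t, measurable B & A = increment W v u @^-1` B]]
      `|` P.-negligible >>.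

Definition measurable_wrt (R : realType) (T : Type) (F : set_system T)
    (X : T -> R) : Prop :=
  forall B : set R, measurable B -> F (X @^-1` B).

(* Elements of L^2(Omega, F_t) are handled through representatives; equality in
   L^2 is [_ = _ %[ae P]]. *)
Definition ms_space (R : realType) (d : measure_display)
    (Omega : measurableType d) (P : probability Omega R)
    (W : R -> {RV P >-> R}) (t : R) : set (Omega -> R) :=
  [set X | X \in Lfun P 2%:E /\ measurable_wrt (wiener_filtration W t) X].

Definition ms_norm (R : realType) (d : measure_display)
    (Omega : measurableType d) (P : probability Omega R) (X : Omega -> R) : R :=
  Num.sqrt (fine 'E_P[fun w => `|X w| ^+ 2]).

(* Only the indices [i < sp_size] of [sp_coef] are relevant: the process is
   \sum_(i < sp_size) sp_coef i * 1_(]sp_time i, sp_time i.+1]). *)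
Record simple_process (R : realType) (d : measure_display)
    (Omega : measurableType d) (P : probability Omega R)
    (W : R -> {RV P >-> R}) (a b : R) := SimpleProcess {
  sp_size : nat;
  sp_time : nat -> R;
  sp_coef : nat -> Omega -> R;
  sp_time_first : sp_time 0%N = a;
  sp_time_last : sp_time sp_size = b;
  sp_time_le : forall i, (i < sp_size)%N -> sp_time i <= sp_time i.+1;
  sp_coef_adapted : forall i, (i < sp_size)%N ->
    measurable_wrt (wiener_filtration W (sp_time i)) (sp_coef i);
  sp_coef_bounded : forall i, (i < sp_size)%N ->
    exists M : R, forall w, `|sp_coef i w| <= M }.

Definition sp_value (R : realType) (d : measure_display)
    (Omega : measurableType d) (P : probability Omega R)
    (W : R -> {RV P >-> R}) (a b : R) (S : simple_process W a b)
    (u : R) (w : Omega) : R :=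
  \sum_(i < sp_size S)
    sp_coef S i w * \1_(`]sp_time S i, sp_time S i.+1]%classic) u.

Definition sp_integral (R : realType) (d : measure_display)
    (Omega : measurableType d) (P : probability Omega R)
    (W : R -> {RV P >-> R}) (a b : R) (S : simple_process W a b)
    (w : Omega) : R :=
  \sum_(i < sp_size S)
    sp_coef S i w * increment W (sp_time S i) (sp_time S i.+1) w.

Definition ito_integrand (R : realType) (d : measure_display)
    (Omega : measurableType d) (P : probability Omega R)
    (W : R -> {RV P >-> R}) (a b : R) (H : R -> Omega -> R) : Prop :=
  [/\ measurable_fun (`[a, b]%classic `*` [set: Omega])
        (fun z : measurableTypeR R * Omega => H z.1 z.2),
      (forall u, a <= u <= b -> measurable_wrt (wiener_filtration W u) (H u)) &
      (\int[lebesgue_measure]_(u in `[a, b]) 'E_P[fun w => (H u w ^+ 2)%R]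
         < +oo)%E].

Definition is_ito_integral (R : realType) (d : measure_display)
    (Omega : measurableType d) (P : probability Omega R)
    (W : R -> {RV P >-> R}) (a b : R) (H : R -> Omega -> R)
    (I : Omega -> R) : Prop :=
  [/\ ito_integrand W a b H, I \in Lfun P 2%:E &
      exists S : nat -> simple_process W a b,
        (\int[lebesgue_measure]_(u in `[a, b])
            'E_P[fun w => ((H u w - sp_value (S k) u w) ^+ 2)%R])%E
          @[k --> \oo] --> 0%E /\
        'E_P[fun w => ((I w - sp_integral (S k) w) ^+ 2)%R]%E
          @[k --> \oo] --> 0%E].

(* Z solves dZ = (alpha Z + beta E Z) dt + Z dW on [s, +oo[ with Z_s = X. *)
Definition mf_sde_solution (R : realType) (d : measure_display)
    (Omega : measurableType d) (P : probability Omega R)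
    (W : R -> {RV P >-> R}) (alpha beta s : R) (X : Omega -> R)
    (Z : R -> Omega -> R) : Prop :=
  Z s = X %[ae P] /\
  forall t, s <= t ->
    ms_space W t (Z t) /\
    exists2 I : Omega -> R, is_ito_integral W s t Z I &
      {ae P, forall w, Z t w =
         Z s w
         + \int[lebesgue_measure]_(u in `[s, t])
             (alpha * Z u w + beta * fine 'E_P[Z u])
         + I w}.

(* [Phi t s] is the solution operator from time s to time t; it is unconstrained
   for t < s and outside [ms_space W s]. *)
Definition generated_by_mf_sde (R : realType) (d : measure_display)
    (Omega : measurableType d) (P : probability Omega R)
    (W : R -> {RV P >-> R}) (alpha beta : R)
    (Phi : R -> R -> (Omega -> R) -> (Omega -> R)) : Prop :=
  forall (s : R) (X : Omega -> R), ms_space W s X ->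
    exists2 Z : R -> Omega -> R, mf_sde_solution W alpha beta s X Z &
      forall t, s <= t ->
        ms_space W t (Phi t s X) /\ Phi t s X = Z t %[ae P].

(* A linear subspace of L^2(Omega, F_t), as a set of representatives closed
   under almost sure equality. *)
Definition ms_subspace (R : realType) (d : measure_display)
    (Omega : measurableType d) (P : probability Omega R)
    (W : R -> {RV P >-> R}) (t : R) (V : set (Omega -> R)) : Prop :=
  [/\ V `<=` ms_space W t,
      V (fun=> 0),
      (forall (a : R) (X Y : Omega -> R),
         V X -> V Y -> V (fun w => a * X w + Y w)) &
      (forall X Y : Omega -> R,
         V X -> ms_space W t Y -> X = Y %[ae P] -> V Y)].

Definition ms_direct_sum (R : realType) (d : measure_display)
    (Omega : measurableType d) (P : probability Omega R)
    (W : R -> {RV P >-> R}) (t : R) (U S : set (Omega -> R)) : Prop :=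
  [/\ ms_subspace W t U, ms_subspace W t S,
      (forall X, ms_space W t X -> exists Y Y' : Omega -> R,
         [/\ U Y, S Y' & X = (fun w => Y w + Y' w) %[ae P]]) &
      (forall X, U X -> S X -> X = (fun=> 0) %[ae P])].

Definition exponential_dichotomy (R : realType) (d : measure_display)
    (Omega : measurableType d) (P : probability Omega R)
    (W : R -> {RV P >-> R}) (Phi : R -> R -> (Omega -> R) -> (Omega -> R))
    (gamma : R) : Prop :=
  exists (K kappa : R) (U S : R -> set (Omega -> R)),
    [/\ 0 < K, 0 < kappa,
        (forall t, ms_direct_sum W t (U t) (S t)),
        (forall (s t : R) (X : Omega -> R), s <= t -> S s X ->
           ms_norm P (Phi t s X)
             <= K * expR ((gamma - kappa) * (t - s)) * ms_norm P X) &
        (forall (s t : R) (X : Omega -> R), s <= t -> U s X ->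
           K^-1 * expR ((gamma + kappa) * (t - s)) * ms_norm P X
             <= ms_norm P (Phi t s X))].

Definition ms_dichotomy_spectrum (R : realType) (d : measure_display)
    (Omega : measurableType d) (P : probability Omega R)
    (W : R -> {RV P >-> R}) (Phi : R -> R -> (Omega -> R) -> (Omega -> R)) :
    set R :=
  [set gamma | ~ exponential_dichotomy W Phi gamma].

(* Main.v *)
Require Import Defs.
From HB Require Import structures.
From mathcomp Require Import all_boot all_order all_algebra.
From mathcomp Require Import ring lra.
From mathcomp Require Import all_classical all_reals all_analysis.
From mathcomp Require Import measurable_realfun.

(** The flow is understood through one formula. Let X be in L^2(F_s), put
    m = E X, tau = t - s and k = 2 beta - 1. Then
      E |Phi_{t,s} X|^2 = e^{(2 alpha + 1) tau}
        (Var X + m^2 (int_0^tau e^{k r} dr + e^{k tau})),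
    which is [Phi_norm]. So a centred X grows exactly like
    e^{(alpha + 1/2) tau}, and the mean adds a component growing like
    e^{(alpha + beta) tau}, which is visible only if k > 0.

    From the formula, if beta <= 1/2 every norm grows like
    e^{(alpha + 1/2) tau}, up to a constant below and a factor 1 + tau above;
    then a rate above alpha + 1/2 has a dichotomy in which everything is
    stable, a rate below it one in which everything is unstable. If beta > 1/2
    the growth of any norm lies between the two rates, and a rate strictly
    between them is separated by the splitting of L^2(F_t) into constants
    (unstable) and centred variables (stable). At alpha + 1/2 the lower bound
    empties the stable space, so that a Wiener increment would be unstable; at
    alpha + beta > alpha + 1/2 the upper bound empties the unstable space, so
    that the constant 1 would be stable. Both contradict their exact growth.

    The formula does not go through the Ito formula. Write
      Z_t = Z_s + int_s^t (alpha Z_u + beta E Z_u) du + N_t,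
    with N the stochastic integral of Z. Pairing this identity in L^2 with a
    fixed G gives, for phi_G(t) = Cov(G, Z_t), the Volterra equation
      phi_G(t) = phi_G(s) + alpha int_s^t phi_G(u) du + E[G N_t].
    The choices G = Z_s, G = N_q and G = Z_q, the isometry
      E[N_q N_t] = int_s^{min(q, t)} E[Z_u^2] du   ([ito_covariance])
    and E[Z_s N_t] = 0 make these equations closed. Uniqueness for Volterra
    equations then determines Cov(Z_q, Z_t), and on the diagonal the variance
    is seen to satisfy v' = (2 alpha + 1) v + (E Z)^2 ([variance_derive]).

    The isometry rests on the independence of F_a and W_b - W_a
    ([wiener_filtration_indep]), by two applications of the pi-lambda theorem,
    and on the first two moments of the normal law ([normal_moments]). *)

Set Implicit Arguments.
Unset Strict Implicit.
Unset Printing Implicit Defensive.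

Import Order.TTheory GRing.Theory Num.Theory.
Import numFieldNormedType.Exports.

Local Open Scope classical_set_scope.
Local Open Scope ring_scope.

(** * Square-integrable functions and their inner product *)

Section square_integrable.
Context d (T : measurableType d) (R : realType).
Variable mu : {measure set T -> \bar R}.
Implicit Types f g h : T -> R.

(** Square integrability is kept as a predicate on functions, rather than as
    membership in a space of classes, so that it also serves on the product of
    a time interval and the probability space. *)
Definition sqint f :=
  measurable_fun setT f /\ mu.-integrable setT (fun x => (f x ^+ 2)%:E).

Definition ip f g : R := \int[mu]_x (f x * g x).

Lemma sqint_mul f g : sqint f -> sqint g ->
  mu.-integrable setT (fun x => (f x * g x)%:E).
Proof.
move=> [mf if2] [mg ig2].
apply: (le_integrable measurableT _ _ (integrableD measurableT if2 ig2)).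
  by apply/measurable_EFinP; exact: measurable_funM.
move=> x _ /=; rewrite lee_fin normrM [leRHS]ger0_norm ?addr_ge0 ?sqr_ge0//.
rewrite -(real_normK (num_real (f x))) -(real_normK (num_real (g x))).
have := sqr_ge0 (`|f x| - `|g x|).
have := sqr_ge0 (`|f x|); have := sqr_ge0 (`|g x|); nra.
Qed.

Lemma sqintZ a f : sqint f -> sqint (fun x => a * f x).
Proof.
move=> [mf if2]; split; first exact: measurable_funM.
apply: eq_integrable (integrableZl measurableT (a ^+ 2) if2) => // x _.
by rewrite -EFinM exprMn.
Qed.

Lemma sqintD f g : sqint f -> sqint g -> sqint (fun x => f x + g x).
Proof.
move=> sf sg; split; first by case: sf sg => mf _ [mg _]; exact: measurable_funD.
have h := integrableZl measurableT 2 (sqint_mul sf sg).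
have h2 := integrableD measurableT (integrableD measurableT sf.2 sg.2) h.
apply: eq_integrable h2 => // x _ /=.
by rewrite -EFinM -!EFinD; congr EFin; ring.
Qed.

Lemma sqintB f g : sqint f -> sqint g -> sqint (fun x => f x - g x).
Proof.
move=> sf sg; have := sqintD sf (sqintZ (-1) sg).
by congr sqint; apply/funext => x; rewrite mulN1r.
Qed.

Lemma sqint0 : sqint (fun=> 0).
Proof.
split; first exact: measurable_cst.
by apply: eq_integrable (integrable0 mu setT) => // x _; rewrite /= expr0n.
Qed.

Lemma sqint_sum n (F : nat -> T -> R) :
  (forall i, (i < n)%N -> sqint (F i)) -> sqint (fun x => \sum_(i < n) F i x).
Proof.
elim: n => [|n ih] sF.
  by have := sqint0; congr sqint; apply/funext => x; rewrite big_ord0.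
rewrite (_ : (fun _ => _) = (fun x => \sum_(i < n) F i x + F n x)).
  by apply: sqintD; [apply: ih => i /ltnW /sF|exact: sF].
by apply/funext => x; rewrite big_ord_recr.
Qed.

Lemma ipC f g : ip f g = ip g f.
Proof. by apply: eq_Rintegral => x _; rewrite mulrC. Qed.

Lemma ipDl f g h : sqint f -> sqint g -> sqint h ->
  ip (fun x => f x + g x) h = ip f h + ip g h.
Proof.
move=> sf sg sh; rewrite /ip -RintegralD//; [|exact: sqint_mul..].
by apply: eq_Rintegral => x _; rewrite mulrDl.
Qed.

Lemma ipZl a f g : sqint f -> sqint g -> ip (fun x => a * f x) g = a * ip f g.
Proof.
move=> sf sg; rewrite /ip -RintegralZl//; last exact: sqint_mul.
by apply: eq_Rintegral => x _; rewrite mulrA.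
Qed.

Lemma ipDr f g h : sqint f -> sqint g -> sqint h ->
  ip h (fun x => f x + g x) = ip h f + ip h g.
Proof. by move=> *; rewrite ipC ipDl// ipC (ipC g). Qed.

Lemma ipZr a f g : sqint f -> sqint g -> ip g (fun x => a * f x) = a * ip g f.
Proof. by move=> *; rewrite ipC ipZl// ipC. Qed.

Lemma ipBl f g h : sqint f -> sqint g -> sqint h ->
  ip (fun x => f x - g x) h = ip f h - ip g h.
Proof.
move=> sf sg sh; rewrite /ip -RintegralB//; [|exact: sqint_mul..].
by apply: eq_Rintegral => x _; rewrite mulrBl.
Qed.

Lemma ipBr f g h : sqint f -> sqint g -> sqint h ->
  ip h (fun x => f x - g x) = ip h f - ip h g.
Proof. by move=> *; rewrite ipC ipBl// ipC (ipC g). Qed.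

Lemma ip0l g : ip (fun=> 0) g = 0.
Proof.
rewrite /ip; under eq_Rintegral do rewrite mul0r.
by rewrite /Rintegral integral0_eq.
Qed.

Lemma ip_suml n (F : nat -> T -> R) g :
  (forall i, (i < n)%N -> sqint (F i)) -> sqint g ->
  ip (fun x => \sum_(i < n) F i x) g = \sum_(i < n) ip (F i) g.
Proof.
move=> + sg; elim: n => [|n ih] sF.
  rewrite big_ord0 -[RHS](ip0l g); congr ip.
  by apply/funext => x; rewrite big_ord0.
rewrite (_ : (fun _ => _) = (fun x => \sum_(i < n) F i x + F n x)); last first.
  by apply/funext => x; rewrite big_ord_recr.
rewrite ipDl//; [|by apply: sqint_sum => i /ltnW /sF|exact: sF].
  by rewrite big_ord_recr/= ih// => i /ltnW /sF.
Qed.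

Lemma ip_ge0 f : 0 <= ip f f.
Proof. by apply: Rintegral_ge0 => x _; rewrite -expr2 sqr_ge0. Qed.

(** The quadratic polynomial x |-> <f + x g, f + x g> is nonnegative; it is
    evaluated at its minimum, or, if <g, g> = 0, at a point where a nonzero
    <f, g> would make it negative. *)
Lemma ip_cauchy_schwarz f g : sqint f -> sqint g ->
  ip f g ^+ 2 <= ip f f * ip g g.
Proof.
move=> sf sg.
have Q x : 0 <= ip f f + 2 * x * ip f g + x ^+ 2 * ip g g.
  have := ip_ge0 (fun w => f w + x * g w).
  have sxg := sqintZ x sg.
  rewrite ipDl ?ipDr ?ipZl ?ipZr//; last exact: sqintD.
  by rewrite (ipC g f) expr2; lra.
have := ip_ge0 g; rewrite le_eqVlt => /predU1P[g0|g0].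
  rewrite -g0 mulr0; have [->|b0] := eqVneq (ip f g) 0; first by rewrite expr0n.
  (* this point makes the affine polynomial equal to -1 *)
  have := Q (- (ip f f + 1) / (2 * ip f g)); rewrite -g0 mulr0 addr0.
  have -> : 2 * (- (ip f f + 1) / (2 * ip f g)) * ip f g = - (ip f f + 1).
    by field.
  lra.
have := Q (- ip f g / ip g g).
have -> : ip f f + 2 * (- ip f g / ip g g) * ip f g +
   (- ip f g / ip g g) ^+ 2 * ip g g = (ip f f * ip g g - ip f g ^+ 2) / ip g g.
  by field; rewrite gt_eqF.
by rewrite pmulr_lge0 ?invr_gt0// subr_ge0.
Qed.

Lemma ip_cvg0 (e : nat -> T -> R) h : (forall k, sqint (e k)) -> sqint h ->
  ip (e k) (e k) @[k --> \oo] --> (0:R) -> ip (e k) h @[k --> \oo] --> (0:R).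
Proof.
move=> se sh e0; apply/norm_cvg0P.
have h0 : Num.sqrt (ip (e k) (e k) * ip h h) @[k --> \oo] --> (0:R).
  rewrite -[X in _ --> X]sqrtr0; apply: continuous_cvg; first exact: sqrt_continuous.
  by rewrite -[X in _ --> X](mul0r (ip h h)); apply: cvgM => //; exact: cvg_cst.
apply: squeeze_cvgr h0; last exact: (cvg_cst (0:R)).
near=> k; rewrite normr_ge0/= -sqrtr_sqr ler_wsqrtr//.
exact: ip_cauchy_schwarz.
Unshelve. all: by end_near. Qed.

(** Joint continuity of the inner product; it transfers the isometry from
    simple integrands to their limits, on both sides at once. *)
Lemma ip_cvg (fk gk : nat -> T -> R) f g :
  sqint f -> sqint g -> (forall k, sqint (fk k)) -> (forall k, sqint (gk k)) ->
  ip (fun x => f x - fk k x) (fun x => f x - fk k x) @[k --> \oo] --> (0:R) ->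
  ip (fun x => g x - gk k x) (fun x => g x - gk k x) @[k --> \oo] --> (0:R) ->
  ip (fk k) (gk k) @[k --> \oo] --> ip f g.
Proof.
move=> sf sg sfk sgk f0 g0.
pose e k x := f x - fk k x; pose e' k x := g x - gk k x.
have se k : sqint (e k) by exact: sqintB.
have se' k : sqint (e' k) by exact: sqintB.
have E k : ip (fk k) (gk k) =
    ip f g - ip (e k) g - ip (e' k) f + ip (e k) (e' k).
  rewrite (ipBl sf (sfk k) (se' k)) (ipBl sf (sfk k) sg) (ipC (e' k) f).
  by rewrite (ipBr sg (sgk k) sf) (ipBr sg (sgk k) (sfk k)); ring.
under eq_fun do rewrite E.
suff: ip f g - ip (e k) g - ip (e' k) f + ip (e k) (e' k) @[k --> \oo] -->
  ip f g - 0 - 0 + 0 by rewrite !subr0 addr0.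
have c1 := ip_cvg0 se sg f0; have c2 := ip_cvg0 se' sf g0.
apply: cvgD; first by apply: cvgB => //; apply: cvgB => //; exact: cvg_cst.
apply/norm_cvg0P.
have h0 : Num.sqrt (ip (e k) (e k) * ip (e' k) (e' k)) @[k --> \oo] --> (0:R).
  rewrite -[X in _ --> X]sqrtr0; apply: continuous_cvg; first exact: sqrt_continuous.
  by rewrite -[X in _ --> X](mul0r (0:R)); exact: cvgM.
apply: squeeze_cvgr h0; last exact: (cvg_cst (0:R)).
near=> k; rewrite normr_ge0/= -sqrtr_sqr ler_wsqrtr//.
exact: ip_cauchy_schwarz.
Unshelve. all: by end_near. Qed.

Lemma eq_ip_ae f f' g : measurable_fun setT f -> measurable_fun setT f' ->
  measurable_fun setT g ->
  f = f' %[ae mu] -> ip f g = ip f' g.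
Proof.
move=> mf mf' mg ff'; rewrite /ip /Rintegral; congr fine.
apply: ae_eq_integral => //; [by apply/measurable_EFinP; exact: measurable_funM..|].
by apply: filterS ff' => x + _ => /(_ I) ->.
Qed.

End square_integrable.

Section sqint_extra.
Context d (T : measurableType d) (R : realType) (mu : {measure set T -> \bar R}).

Lemma sqint_bounded (c X : T -> R) (M : R) : measurable_fun setT c ->
  (forall w, `|c w| <= M) -> sqint mu X -> sqint mu (fun w => c w * X w).
Proof.
move=> mc cM [mX X2]; split; first exact: measurable_funM.
apply: (le_integrable measurableT _ _ (integrableZl measurableT (M ^+ 2) X2)).
  by apply/measurable_EFinP; apply: measurable_funX; exact: measurable_funM.
move=> w _ /=; rewrite lee_fin exprMn.
have n2 (x y : R) : `|x ^+ 2 * y ^+ 2| = x ^+ 2 * y ^+ 2.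
  by rewrite ger0_norm// mulr_ge0// sqr_ge0.
rewrite !n2; apply: ler_wpM2r; first exact: sqr_ge0.
rewrite -(real_normK (num_real (c w))).
by rewrite lerXn2r ?nnegrE// (le_trans _ (cM w)).
Qed.

Lemma sqint_cst (r : R) : (mu setT < +oo)%E -> sqint mu (fun=> r).
Proof.
move=> mu_fin; split; first exact: measurable_cst.
apply/integrableP; split; first exact: measurable_cst.
by rewrite integral_cst//= lte_mul_pinfty.
Qed.

Lemma sqint_integrable (f : T -> R) : (mu setT < +oo)%E -> sqint mu f ->
  mu.-integrable setT (EFin \o f).
Proof.
move=> mu_fin sf; have s1 := sqint_cst 1 mu_fin.
by apply: eq_integrable (sqint_mul sf s1) => // x _; rewrite mulr1.
Qed.

Lemma sqint_Lfun (f : T -> R) : f \in Lfun mu 2%:E -> sqint mu f.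
Proof.
move=> lf; split; last exact: Lfun2_integrable_sqr.
by move: lf; rewrite inE => /andP[]; rewrite inE.
Qed.

Lemma ip_expectation (f : T -> R) : ip mu f f = fine (\int[mu]_x (f x ^+ 2)%:E).
Proof. by rewrite /ip /Rintegral; under eq_integral do rewrite -expr2. Qed.

Lemma sqint_in_Lfun (f : T -> R) : sqint mu f -> f \in Lfun mu 2%:E.
Proof.
move=> [mf f2]; rewrite inE; apply/andP; split; rewrite inE//=.
rewrite /finite_norm unlock; apply: poweR_lty.
rewrite (eq_integral (fun x => (f x ^+ 2)%:E)); first exact: integrable_lty.
by move=> x _; rewrite /= powR_mulrn// real_normK ?num_real.
Qed.

End sqint_extra.

Section probability_ip.
Context d (Omega : measurableType d) (R : realType) (P : probability Omega R).

Lemma probability_lty : (P setT < +oo)%E.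
Proof. by rewrite probability_setT ltry. Qed.

Lemma sqint1 : sqint P (fun=> 1).
Proof. exact: sqint_cst probability_lty. Qed.

Lemma ip11 : ip P (fun=> 1) (fun=> 1) = 1.
Proof.
rewrite /ip /Rintegral; under eq_integral do rewrite mulr1.
by have := expectation_cst P 1; rewrite unlock => ->.
Qed.

End probability_ip.

(** * Moments of the centred normal law *)

Section normal_moments.
Context (R : realType) (s : R).
Hypothesis s_gt0 : 0 < s.
Notation mu := (@lebesgue_measure R).
Notation nu := (normal_prob 0 s).
Notation pdf := (normal_pdf 0 s).

Let s_neq0 : s != 0. Proof. by rewrite gt_eqF. Qed.

(** The density is the Radon-Nikodym derivative up to a null set, which turns
    integrals against the law into Lebesgue integrals. *)
Lemma ge0_integral_normal_prob (f : R -> \bar R) :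
  measurable_fun setT f -> (forall x, 0 <= f x)%E ->
  (\int[nu]_x f x = \int[mu]_x (f x * (pdf x)%:E))%E.
Proof.
move=> mf f0.
have dom := normal_prob_dominates (0:R) s.
rewrite -(Radon_Nikodym_SigmaFinite.change_of_variables dom f0 measurableT mf).
have iRN := Radon_Nikodym_SigmaFinite.f_integrable dom.
apply: ae_eq_integral => //.
- by apply: emeasurable_funM => //; exact: measurable_int iRN.
- apply: emeasurable_funM => //; apply/measurable_EFinP.
  exact: measurable_normal_pdf.
- apply: ae_eqe_mul2l; apply: integral_ae_eq => //.
  + apply/measurable_EFinP; exact: measurable_normal_pdf.
  + by move=> E _ mE; rewrite -Radon_Nikodym_SigmaFinite.f_integral.
Qed.

Let pdfE x : pdf x = normal_peak s * expR (- (x ^+ 2 / (s ^+ 2 *+ 2))).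
Proof. by rewrite normal_pdfE// /normal_fun subr0 mulNr. Qed.

Let pdfN x : pdf (- x) = pdf x.
Proof. by rewrite !pdfE sqrrN. Qed.

Let cpdf : continuous pdf.
Proof. exact: continuous_normal_pdf. Qed.

Lemma ge0_integral_normal_probN (f : R -> \bar R) :
  measurable_fun setT f -> (forall x, 0 <= f x)%E ->
  (\int[nu]_x f (- x)%R = \int[nu]_x f x)%E.
Proof.
move=> mf f0.
have mN : measurable_fun [set: measurableTypeR R]
    (-%R : measurableTypeR R -> measurableTypeR R) by exact: measurable_funN.
rewrite !ge0_integral_normal_prob//; last first.
  by apply: measurableT_comp => //.
have mg : measurable_fun setT (fun x => f x * (pdf x)%:E)%E.
  apply: emeasurable_funM => //; apply/measurable_EFinP.
  exact: measurable_normal_pdf.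
have g0 x : (0 <= f x * (pdf x)%:E)%E.
  by rewrite mule_ge0// lee_fin normal_pdf_ge0.
transitivity (\int[pushforward mu (-%R : _ -> measurableTypeR R)]_x
    (f x * (pdf x)%:E))%E.
  have E := ge0_integral_pushforward mN
    (lebesgue_measure : {measure set (measurableTypeR R) -> \bar R})
    measurableT mg (fun x _ => g0 x).
  apply: (eq_trans _ (esym E)).
  by apply: eq_integral => x _ /=; rewrite pdfN.
by apply: eq_measure_integral => A mA _; exact: lebesgue_measureN.
Qed.

Let antiderivative (x : R) : is_derive x 1 (fun x : R => - (s ^+ 2 * pdf x)) (x * pdf x).
Proof.
rewrite (_ : (fun _ => _) = (fun x => (- (s ^+ 2 * normal_peak s)) *
   expR (- (x ^+ 2 / (s ^+ 2 *+ 2))))); last first.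
  by apply/funext => y; rewrite pdfE mulrA mulNr.
have d1 : is_derive x 1 (fun x : R => - (x ^+ 2 / (s ^+ 2 *+ 2))) (- (x / s ^+ 2)).
  rewrite (_ : (fun _ => _) = (fun x : R => (- (s ^+ 2 *+ 2)^-1) * x ^+ 2)).
    apply: is_derive_eq; rewrite /GRing.scale/=.
    by field.
  by apply/funext => y; rewrite mulrC mulNr.
have d2 := is_derive1_comp (is_derive_expR _) d1.
apply: is_derive_eq.
by rewrite pdfE /GRing.scale/=; field.
Qed.

(** Boundary term of the integration by parts in [normal_second_moment]; it
    vanishes because e^y >= y for y = n^2 / (2 s^2). *)
Let boundary : s ^+ 2 * (n%:R * pdf n%:R) @[n --> \oo] --> (0 : R).
Proof.
have c0 : (s ^+ 2 * normal_peak s * (s ^+ 2 *+ 2)) * (n.+1%:R)^-1 @[n --> \oo] --> (0 : R).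
  rewrite -[X in _ --> X](mulr0 (s ^+ 2 * normal_peak s * (s ^+ 2 *+ 2))).
  by apply: cvgM; [exact: cvg_cst|exact: cvg_harmonic].
rewrite -(cvg_shiftS _).
apply: squeeze_cvgr c0; last exact: (cvg_cst (0:R)).
near=> n; apply/andP; split.
  by rewrite mulr_ge0 ?sqr_ge0// mulr_ge0// normal_pdf_ge0.
have n0 : 0 < n.+1%:R :> R by rewrite ltr0n.
have s20 : 0 < s ^+ 2 *+ 2 by rewrite pmulrn_lgt0// exprn_gt0.
suff h : n.+1%:R * expR (- (n.+1%:R ^+ 2 / (s ^+ 2 *+ 2))) <=
    (s ^+ 2 *+ 2) / n.+1%:R.
  have {}h := ler_wpM2l (mulr_ge0 (sqr_ge0 s) (normal_peak_ge0 s)) h.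
  apply: le_trans (le_trans h _); last by rewrite !mulrA.
  rewrite -[leLHS]/(s ^+ 2 * (n.+1%:R * pdf n.+1%:R)) pdfE.
  by rewrite le_eqVlt; apply/orP; left; apply/eqP; ring.
rewrite expRN ler_pdivrMr ?expR_gt0//.
apply: (@le_trans _ _ ((s ^+ 2 *+ 2) * (n.+1%:R)^-1 * (n.+1%:R ^+ 2 / (s ^+ 2 *+ 2)))).
  rewrite le_eqVlt; apply/orP; left; apply/eqP; field.
  by rewrite gt_eqF//=.
rewrite ler_wpM2l//; first by rewrite mulr_ge0 ?invr_ge0// ltW.
by apply: le_trans (expR_ge1Dx _); rewrite lerDr.
Unshelve. all: by end_near. Qed.

(** Integration by parts on [0, n] with x dG, where G = - s^2 pdf is an
    antiderivative of x pdf, expresses the truncated second moment through the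
    truncated mass, which tends to 1/2. *)
Lemma normal_second_moment : (\int[nu]_x (x ^+ 2)%:E = (s ^+ 2)%:E)%E.
Proof.
have mX2 : measurable_fun setT (fun x : R => (x ^+ 2)%:E).
  by apply/measurable_EFinP; exact: measurable_funX.
rewrite ge0_integral_normal_prob//; last by move=> x; rewrite lee_fin sqr_ge0.
have c2 : continuous (fun x : R => x ^+ 2 * pdf x).
  by move=> x; apply: cvgM; [exact: exprn_continuous|exact: cpdf].
have halfE (g : R -> R) : (forall x, 0 <= g x) -> continuous g ->
    g =1 g \o -%R ->
    (\int[mu]_x (g x)%:E = 2%:E * \int[mu]_(x in `[0%R, +oo[) (g x)%:E)%E.
  move=> g0 cg gN; rewrite ge0_symfun_integralT//; congr (_ * _)%E.
  congr (integral _ _ _); apply/seteqP.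
  by split => x/=; rewrite in_itv/= andbT.
have pdf0 x : 0 <= pdf x by exact: normal_pdf_ge0.
have f0 x : 0 <= x ^+ 2 * pdf x by rewrite mulr_ge0 ?sqr_ge0.
have half : (\int[mu]_(x in `[0%R, +oo[) (pdf x)%:E = (2^-1)%:E)%E.
  have := integral_normal_pdf (0:R) s; rewrite halfE//; last first.
    by move=> x; rewrite /= pdfN.
  move=> /(congr1 (fun z => (2^-1)%:E * z)%E); rewrite mule1 muleA -EFinM.
  by rewrite mulVf ?pnatr_eq0// mul1e.
have mpdf : measurable_fun setT pdf by exact: measurable_normal_pdf.
under eq_integral do rewrite -EFinM.
rewrite halfE//; last by move=> x; rewrite /= pdfN sqrrN.
suff -> : (\int[mu]_(x in `[0%R, +oo[) (x ^+ 2 * pdf x)%:E =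
          (s ^+ 2 * 2^-1)%:E)%E.
  by rewrite -EFinM; congr EFin; field.
have mf : measurable_fun setT (fun x : R => x ^+ 2 * pdf x).
  by apply: measurable_funM => //; exact: measurable_funX.
have lim1 := @ge0_cvgn_integral R mu _ f0 mf.
have lim2 := @ge0_cvgn_integral R mu _ pdf0 mpdf.
have iS n : (\int[mu]_(x in `[0%R, n.+1%:R]) (x ^+ 2 * pdf x)%:E =
   (s ^+ 2)%:E * \int[mu]_(x in `[0%R, n.+1%:R]) (pdf x)%:E
    - (s ^+ 2 * (n.+1%:R * pdf n.+1%:R))%:E)%E.
  have cid : continuous (@idfun R) by move=> x; exact: cvg_id.
  have cG : continuous (fun x => - (s ^+ 2 * pdf x)).
    by move=> x; apply: cvgN; apply: cvgM; [exact: cvg_cst|exact: cpdf].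
  transitivity (\int[mu]_(x in `[0%R, n.+1%:R]) (idfun x * (x * pdf x))%:E)%E.
    by apply: eq_integral => x _; rewrite mulrA -expr2.
  rewrite (@integration_by_parts _ idfun (fun x => - (s ^+ 2 * pdf x)) (cst 1)
    (fun x => x * pdf x)) ?ltr0n//.
  - rewrite /= mul0r subr0.
    rewrite mulrN EFinN addeC; congr (_ + _)%E; last by rewrite -?EFinN mulrCA.
    transitivity (- ((- s ^+ 2)%:E *
        \int[mu]_(x in `[0%R, n.+1%:R]) (pdf x)%:E))%E; last first.
      by rewrite EFinN mulNe oppeK.
    congr (- _)%E; rewrite -integralZl//=; last first.
      by apply: integrableS (integrable_normal_pdf 0 s).
    by apply: eq_integral => x _; rewrite mul1r -EFinM mulNr.
  - by apply: continuous_subspaceT => x; exact: cvg_cst.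
  - split => //.
    + by apply: cvg_at_right_filter; exact: cid.
    + by apply: cvg_at_left_filter; exact: cid.
  - by move=> x _; rewrite derive1E derive_id.
  - by apply: continuous_subspaceT => x; apply: cvgM; [exact: cid|exact: cpdf].
  - split.
    + by move=> x _; exact: ex_derive.
    + by apply: cvg_at_right_filter; exact: cG.
    + by apply: cvg_at_left_filter; exact: cG.
  - by move=> x _; rewrite derive1E; exact: derive_val.
have shift (u : nat -> \bar R) (l : \bar R) :
    u n @[n --> \oo] --> l -> u n.+1 @[n --> \oo] --> l by rewrite cvg_shiftS.
move/shift : lim1.
under eq_fun do rewrite iS.
move=> lim1; apply: (cvg_unique _ lim1) => //.
suff : ((s ^+ 2)%:E * \int[mu]_(x in `[0%R, n.+1%:R]) (pdf x)%:E
    - (s ^+ 2 * (n.+1%:R * pdf n.+1%:R))%:E)%E @[n --> \oo] -->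
    ((s ^+ 2)%:E * (2^-1)%:E - 0%:E)%E.
  by rewrite sube0 -EFinM.
apply: cvgeB => //.
- by apply: cvgeZl => //; rewrite -half; exact: (shift _ _ lim2).
- by apply: cvg_EFin; [exact: nearW|rewrite (cvg_shiftS (fun n => s ^+ 2 * (n%:R * pdf n%:R)))].
Qed.

(** The mean vanishes because the law is invariant under x |-> - x, which
    exchanges the positive and the negative part. *)
Lemma normal_moments d (Omega : measurableType d) (P : probability Omega R)
    (X : Omega -> R) : measurable_fun setT X ->
  (forall B, measurable B -> P (X @^-1` B) = nu B) ->
  [/\ sqint P X, ip P X (fun=> 1) = 0 & ip P X X = s ^+ 2].
Proof.
move=> mX PX.
have transfer (f : R -> \bar R) : measurable_fun setT f ->
    (forall x, 0 <= f x)%E -> (\int[P]_w f (X w) = \int[nu]_x f x)%E.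
  move=> mf f0.
  rewrite -(@ge0_integral_pushforward _ _ _ (measurableTypeR R) _ _ mX P setT f)//.
  by apply: eq_measure_integral => B mB _; exact: PX.
have X2 : (\int[P]_w (X w ^+ 2)%:E = (s ^+ 2)%:E)%E.
  rewrite -normal_second_moment (transfer (fun x => (x ^+ 2)%:E))//.
    by apply/measurable_EFinP; exact: measurable_funX.
  by move=> x; rewrite lee_fin sqr_ge0.
have sX : sqint P X.
  split => //; apply/integrableP; split.
    by apply/measurable_EFinP; exact: measurable_funX.
  under eq_integral do rewrite /= ger0_norm ?sqr_ge0//.
  by rewrite X2 ltry.
split => //; last by rewrite /ip /Rintegral; under eq_integral do
  rewrite -expr2; rewrite X2.
have iX := sqint_mul sX (sqint1 P).
rewrite /ip /Rintegral integralE.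
set f := (fun _ => _) in iX *.
have fE : f = (fun w => (X w)%:E) by apply/funext => w; rewrite /f mulr1.
have -> : (\int[P]_x f^\- x = \int[P]_x f^\+ x)%E.
  have mid : measurable_fun setT (fun x : R => x%:E) by exact/measurable_EFinP.
  transitivity (\int[P]_w ((EFin^\-)%E (X w)))%E; first by
    rewrite fE; apply: eq_integral => w _; rewrite !funenegE.
  transitivity (\int[P]_w ((EFin^\+)%E (X w)))%E; last by
    rewrite fE; apply: eq_integral => w _; rewrite !funeposE.
  have mp := measurable_funepos mid; have mn := measurable_funeneg mid.
  rewrite (transfer _ mn) ?(transfer _ mp)//.
  rewrite -(ge0_integral_normal_probN mp)//.
  by apply: eq_integral => x _; rewrite funenegE funeposE.
rewrite subee//; exact: integrable_pos_fin_num.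
Qed.

End normal_moments.

(** * Independence of the past and of the increments *)

Section independence.
Context (R : realType) d (Omega : measurableType d) (P : probability Omega R).

(** Measurability is part of the definition because it has to be carried along
    the pi-lambda argument: the generators of the filtration include null sets,
    which are measurable only because P is complete. *)
Definition indep_event (E : set Omega) : set_system Omega :=
  [set A | measurable A /\ P (A `&` E) = (P A * P E)%E].

Lemma dynkin_indep_event E : measurable E -> dynkin (indep_event E).
Proof.
move=> mE; split.
- by split => //; rewrite setTI probability_setT mul1e.
- move=> A [mA PA]; split; first exact: measurableC.
  rewrite probability_setC// setIC -setDE measureD//; last first.
    by rewrite ltey_eq fin_num_measure.
  rewrite [X in (_ - X)%E](_ : _ = (P A * P E)%E); last by rewrite -PA setIC.
  by rewrite muleBl ?mul1e// ?fin_num_adde_defl// fin_num_measure.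
- move=> F tF DF; split; first by apply: bigcup_measurable => k _; case: (DF k).
  rewrite setI_bigcupl measure_bigcup//; last 2 first.
  + by move=> k _; apply: measurableI => //; case: (DF k).
  + exact: trivIset_setIr.
  rewrite measure_bigcup//; last by move=> k _; case: (DF k).
  rewrite muleC -(fineK (fin_num_measure P E mE)) -nneseriesZl//.
  apply: eq_eseriesr => k _; case: (DF k) => _ PF; apply: (eq_trans PF).
  by rewrite fineK ?fin_num_measure// muleC.
Qed.

Lemma g_sigma_algebra_indep_event (G : set_system Omega) E : measurable E ->
  setI_closed G -> G `<=` indep_event E -> <<s G >> `<=` indep_event E.
Proof.
move=> mE GI GE; rewrite -setI_closed_g_dynkin_g_sigma_algebra//.
exact: smallest_sub (dynkin_indep_event mE) GE.
Qed.

(** Functions adapted to a generated sigma-algebra are the measurable functions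
    on the corresponding measurable space, which gives their stability under
    algebraic operations. *)
Lemma measurable_wrtP (G : set_system Omega) (X : Omega -> R) :
  measurable_wrt <<s G >> X <->
  measurable_fun [set: g_sigma_algebraType G] (X : g_sigma_algebraType G -> R).
Proof.
split=> [h _ B mB|h B mB]; first by rewrite setTI; exact: h.
by have := h measurableT B mB; rewrite setTI.
Qed.

End independence.

Section wiener.
Context (R : realType) d (Omega : measurableType d) (P : probability Omega R).
Variable W : R -> {RV P >-> R}.

Lemma measurable_increment v u : measurable_fun setT (increment W v u).
Proof. exact: measurable_funB. Qed.

Lemma measurable_increment_preimage v u B : measurable B ->
  measurable (increment W v u @^-1` B).
Proof.
by move=> mB; rewrite -[X in measurable X]setTI; exact: measurable_increment.
Qed.

Definition cylinders (t : nat -> R) (n : nat) : set_system Omega :=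
  [set A | exists2 B : nat -> set R, (forall i, measurable (B i)) &
    A = \bigcap_(i < n) (increment W (t i) (t i.+1) @^-1` B i)].

Lemma setI_closed_cylinders t n : setI_closed (cylinders t n).
Proof.
move=> _ _ [B mB ->] [C mC ->]; exists (fun i => B i `&` C i).
  by move=> i; exact: measurableI.
by rewrite bigcapI.
Qed.

Definition increments_among (F : seq R) : set_system Omega :=
  [set A | exists v u (B : set R),
    [/\ v \in F, u \in F, measurable B & A = increment W v u @^-1` B]].

(** An increment between two points of the chain is a difference of sums of
    consecutive increments, and these are measurable for the cylinders. *)
Lemma increments_among_cylinders (t : nat -> R) n (F : seq R) :
  (forall x, x \in F -> exists2 i, (i <= n)%N & x = t i) ->
  <<s increments_among F >> `<=` <<s cylinders t n >>.
Proof.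
move=> Ft; apply: smallest_sub; first exact: smallest_sigma_algebra.
pose G := cylinders t n.
have mstep k : (k < n)%N -> measurable_fun [set: g_sigma_algebraType G]
    (increment W (t k) (t k.+1) : g_sigma_algebraType G -> R).
  move=> kn; apply/measurable_wrtP => B mB; apply: sub_gen_smallest.
  exists (fun i => if i == k then B else setT).
    by move=> i; case: ifP.
  apply/seteqP; split=> w /=.
    by move=> Bw i _ /=; case: eqP => [->|].
  by move=> /(_ k kn) /=; rewrite eqxx.
have m0 k : (k <= n)%N -> measurable_fun [set: g_sigma_algebraType G]
    (increment W (t 0%N) (t k) : g_sigma_algebraType G -> R).
  elim: k => [_|k ih kn].
    rewrite (_ : increment _ _ _ = cst 0); first exact: measurable_cst.
    by apply/funext => w; rewrite /increment subrr.
  rewrite (_ : increment _ _ _ = increment W (t 0%N) (t k)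
    \+ increment W (t k) (t k.+1)); last first.
    by apply/funext => w /=; rewrite /increment; ring.
  by apply: measurable_funD; [exact: (ih (ltnW kn))|exact: mstep].
move=> _ [v [u [B [/Ft[i ni ->] /Ft[j nj ->] mB ->]]]].
have : measurable_wrt <<s G >> (increment W (t i) (t j)).
  apply/measurable_wrtP.
  rewrite (_ : increment _ _ _ = increment W (t 0%N) (t j)
    \- increment W (t 0%N) (t i)); last first.
    by apply/funext => w /=; rewrite /increment; ring.
  by apply: measurable_funB; exact: m0.
exact.
Qed.

Hypothesis wW : two_sided_wiener W.

(** First pi-lambda argument: cylinders over a chain are a pi-system, and on
    them independence is the product rule assumed for the Wiener process. *)
Lemma indep_event_chain (t : nat -> R) n B :
  (forall i, (i < n.+1)%N -> t i <= t i.+1) -> measurable B ->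
  <<s cylinders t n >> `<=`
    indep_event P (increment W (t n) (t n.+1) @^-1` B).
Proof.
case: wW => _ _ _ ind tle mB.
apply: g_sigma_algebra_indep_event.
- exact: measurable_increment_preimage.
- exact: setI_closed_cylinders.
move=> _ [C mC ->]; split.
  by apply: bigcap_measurableType => i _; exact: measurable_increment_preimage.
pose D i := if i == n then B else C i.
have mD i : measurable (D i) by rewrite /D; case: ifP.
have := ind n.+1 t D tle (fun i _ => mD i).
have DnB : D n = B by rewrite /D eqxx.
rewrite big_ord_recr/= DnB.
rewrite (eq_bigr (fun i : 'I_n =>
    P (increment W (t i) (t i.+1) @^-1` C i))); last first.
  by move=> i _; rewrite /D ltn_eqF.
rewrite -ind//; last by move=> i ni; exact/tle/ltnW.
move=> <-; congr (P _); apply/seteqP; split => w /=.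
  move=> [Cw Bw] i /=; rewrite ltnS leq_eqVlt => /predU1P[->|ni].
    by rewrite /D eqxx.
  by rewrite /D ltn_eqF//; exact: Cw.
move=> Dw; split; last by have := Dw n (ltnSn n); rewrite /= /D eqxx.
by move=> i /= ni; have := Dw i (ltnW ni); rewrite /= /D ltn_eqF.
Qed.

(** Sorting F and appending a and b produces a chain in which W b - W a is the
    last increment. *)
Lemma indep_event_increments_among (F : seq R) a b B :
  {in F, forall x, x <= a} -> a <= b -> measurable B ->
  <<s increments_among F >> `<=` indep_event P (increment W a b @^-1` B).
Proof.
move=> Fa ab mB.
(* The indices in use stay below [size s'], so the default value b is inert. *)
pose s := sort <=%O F; pose s' := rcons (rcons s a) b.
pose n := size s; pose t i := nth b s' i.
have tn : t n = a.
  by rewrite /t /s' nth_rcons size_rcons -/n ltnSn nth_rcons ltnn eqxx.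
have tn1 : t n.+1 = b.
  by rewrite /t /s' nth_rcons size_rcons ltnn eqxx.
have ss' : sorted <=%O s'.
  rewrite /s' (sorted_pairwise le_trans) !pairwise_rcons all_rcons ab/=.
  rewrite -(sorted_pairwise le_trans) sort_le_sorted.
  have sa : all (<=%O^~ a) s.
    by apply/allP => x; rewrite mem_sort => /Fa.
  by rewrite sa !andbT; apply/allP => x /(allP sa) /le_trans; exact.
have tle i : (i < n.+1)%N -> t i <= t i.+1.
  move=> ni; apply: (sorted_leq_nth le_trans) => //.
  - by rewrite inE !size_rcons ltnW.
  - by rewrite inE !size_rcons.
have := @indep_event_chain t n B tle mB; rewrite tn tn1.
apply: subset_trans; apply: increments_among_cylinders => x xF.
have xs : x \in s by rewrite mem_sort.
have ix : (index x s < size s)%N by rewrite index_mem.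
exists (index x s); first exact: ltnW.
by rewrite /t /s' !nth_rcons size_rcons ltnS (ltnW ix) ix nth_index.
Qed.

Hypothesis cP : measure_is_complete P.

(** Second pi-lambda argument. The increments before a do not form a pi-system,
    but the union over finite F of the sigma-algebras generated by the
    increments among F does, since those of F and F' are contained in the one of
    F ++ F'. Null sets are added to it; they stay null under intersection. *)
Theorem wiener_filtration_indep a b B : a <= b -> measurable B ->
  wiener_filtration W a `<=` indep_event P (increment W a b @^-1` B).
Proof.
move=> ab mB; have mE := measurable_increment_preimage a b mB.
pose Pi : set_system Omega := [set A | exists2 F : seq R,
   {in F, forall x, x <= a} & <<s increments_among F >> A] `|` P.-negligible.
apply: (@subset_trans _ <<s Pi >>).
  apply: sub_smallest2r; first exact: smallest_sigma_algebra.
  apply: setSU => // _ [v [u [C [vu ua mC ->]]]].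
  exists [:: v; u].
    by move=> x; rewrite !inE => /orP[]/eqP-> //; exact: le_trans ua.
  apply: sub_gen_smallest; exists v, u, C; split => //.
  - by rewrite inE eqxx.
  - by rewrite !inE eqxx orbT.
apply: g_sigma_algebra_indep_event => //.
- move=> A C [[F Fa FA]|nA]; last by move=> _; right; apply: negligibleS nA; exact: subIsetl.
  move=> [[F' F'a F'C]|nC]; last by right; apply: negligibleS nC; exact: subIsetr.
  left; exists (F ++ F').
    by move=> x; rewrite mem_cat => /orP[/Fa|/F'a].
  have sub1 : <<s increments_among F >> `<=` <<s increments_among (F ++ F') >>.
    apply: sub_smallest2r; first exact: smallest_sigma_algebra.
    move=> _ [v [u [D [vF uF mD ->]]]].
    by exists v, u, D; rewrite !mem_cat vF uF.
  have sub2 : <<s increments_among F' >> `<=` <<s increments_among (F ++ F') >>.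
    apply: sub_smallest2r; first exact: smallest_sigma_algebra.
    move=> _ [v [u [D [vF uF mD ->]]]].
    by exists v, u, D; rewrite !mem_cat vF uF !orbT.
  exact: (@measurableI _ (g_sigma_algebraType (increments_among (F ++ F')))
    _ _ (sub1 _ FA) (sub2 _ F'C)).
- move=> A [[F Fa FA]|nA]; first exact: (indep_event_increments_among Fa ab mB).
  have mA := cP nA; split => //.
  have A0 : P A = 0%E by exact/negligibleP.
  rewrite A0 mul0e; apply: (subset_measure0 _ _ _ A0) => //.
  exact: measurableI.
Qed.

End wiener.

(** * Products of independent variables *)

Section tensor.
Context d1 d2 (T1 : measurableType d1) (T2 : measurableType d2) (R : realType).
Variables (m1 : {sigma_finite_measure set T1 -> \bar R})
  (m2 : {sigma_finite_measure set T2 -> \bar R}).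

(** Fubini for a product of one-variable functions; it serves for the joint law
    of independent variables and for the integrals over time and chance. *)
Lemma tensor_integral (F : T1 -> R) (G : T2 -> R) :
  m1.-integrable setT (fun x => (F x)%:E) ->
  m2.-integrable setT (fun y => (G y)%:E) ->
  (m1 \x m2)%E.-integrable setT (fun z : T1 * T2 => (F z.1 * G z.2)%:E) /\
  \int[(m1 \x m2)%E]_z (F z.1 * G z.2) = (\int[m1]_x F x) * (\int[m2]_y G y).
Proof.
move=> iF iG.
have mF : measurable_fun setT F by apply/measurable_EFinP; exact: measurable_int iF.
have mG : measurable_fun setT G by apply/measurable_EFinP; exact: measurable_int iG.
have mmul : measurable_fun setT (fun z : T1 * T2 => (F z.1 * G z.2)%:E).
  apply/measurable_EFinP; apply: measurable_funM.
    by apply: measurableT_comp => //; exact: measurable_fst.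
  by apply: measurableT_comp => //; exact: measurable_snd.
have fF : (\int[m1]_x `|(F x)%:E| < +oo)%E by case/integrableP : iF.
have fG : (\int[m2]_y `|(G y)%:E| < +oo)%E by case/integrableP : iG.
have iprod : (m1 \x m2)%E.-integrable setT
    (fun z : T1 * T2 => (F z.1 * G z.2)%:E).
  apply/integrable12ltyP => //=.
  rewrite (eq_integral (fun x => `|(F x)%:E| * \int[m2]_y `|(G y)%:E|)%E).
    rewrite ge0_integralZr//.
    - by rewrite lte_mul_pinfty// ?integral_ge0// ge0_fin_numE// integral_ge0.
    - by apply: measurableT_comp => //; exact/measurable_EFinP.
    - exact: integral_ge0.
  move=> x _; rewrite -ge0_integralZl//; last first.
    by apply: measurableT_comp => //; exact/measurable_EFinP.
  by apply: eq_integral => y _; rewrite normrM EFinM.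
split => //; rewrite /Rintegral -integral12_prod_meas1//.
have finF : (\int[m1]_x (F x)%:E)%E \is a fin_num by exact: integrable_fin_num.
have finG : (\int[m2]_y (G y)%:E)%E \is a fin_num by exact: integrable_fin_num.
transitivity (fine (\int[m1]_x ((F x)%:E * \int[m2]_y (G y)%:E))%E).
  by congr fine; apply: eq_integral => x _; rewrite -integralZl.
by rewrite -(fineK finG) integralZr// fineM// fineK.
Qed.

End tensor.

Section independent_product.
Context (R : realType) d (Omega : measurableType d) (P : probability Omega R).

(** Independence says that the joint law agrees with the product of the laws on
    rectangles, hence everywhere. *)
Let RV_product (Y Z : {RV P >-> R}) :
  (forall A B, measurable A -> measurable B ->
    P (Y @^-1` A `&` Z @^-1` B) = (P (Y @^-1` A) * P (Z @^-1` B))%E) ->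
  P.-integrable setT (EFin \o Y) -> P.-integrable setT (EFin \o Z) ->
  P.-integrable setT (fun w => (Y w * Z w)%:E) /\
  \int[P]_w (Y w * Z w) = \int[P]_w Y w * \int[P]_w Z w.
Proof.
move=> YZ iY iZ.
have mY : measurable_fun setT Y by [].
have mZ : measurable_fun setT Z by [].
pose V w : R * R := (Y w, Z w).
have mV : measurable_fun setT V by exact: measurable_fun_pair.
pose VR : {RV P >-> (R * R)%type} := HB.pack V (isMeasurableFun.Build _ _ _ _ V mV).
pose mu1 := distribution P Y; pose mu2 := distribution P Z.
have joint A : measurable A -> (mu1 \x mu2)%E A = distribution P VR A.
  apply: product_measure_unique => {}A B mA mB.
  by rewrite /distribution /pushforward -YZ.
have iid1 : mu1.-integrable setT (fun y : R => y%:E).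
  apply/integrableP; split; first exact/measurable_EFinP.
  rewrite ge0_integral_distribution//; first by case/integrableP : iY.
  by apply: measurableT_comp => //; exact/measurable_EFinP.
have iid2 : mu2.-integrable setT (fun y : R => y%:E).
  apply/integrableP; split; first exact/measurable_EFinP.
  rewrite ge0_integral_distribution//; first by case/integrableP : iZ.
  by apply: measurableT_comp => //; exact/measurable_EFinP.
have [iprod Eprod] := tensor_integral iid1 iid2.
have mmul : measurable_fun setT (fun z : R * R => (z.1 * z.2)%:E).
  exact: measurable_int iprod.
have iV : P.-integrable setT (fun w => (Y w * Z w)%:E).
  apply/integrableP; split.
    by apply/measurable_EFinP; exact: measurable_funM.
  case/integrableP : iprod => _; rewrite (eq_measure_integral (distribution P VR)).
    rewrite ge0_integral_distribution//.
    by apply: measurableT_comp.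
  by move=> A mA _; exact: joint.
split => //.
transitivity (\int[(mu1 \x mu2)%E]_z (z.1 * z.2)).
  rewrite /Rintegral; congr fine.
  rewrite [RHS](eq_measure_integral (distribution P VR)).
    by rewrite integral_distribution.
  by move=> A mA _; exact: joint.
rewrite Eprod /Rintegral.
by rewrite !integral_distribution//; exact/measurable_EFinP.
Qed.

Lemma independent_product (Y Z : Omega -> R) :
  measurable_fun setT Y -> measurable_fun setT Z ->
  (forall A B, measurable A -> measurable B ->
    P (Y @^-1` A `&` Z @^-1` B) = (P (Y @^-1` A) * P (Z @^-1` B))%E) ->
  P.-integrable setT (EFin \o Y) -> P.-integrable setT (EFin \o Z) ->
  P.-integrable setT (fun w => (Y w * Z w)%:E) /\
  \int[P]_w (Y w * Z w) = \int[P]_w Y w * \int[P]_w Z w.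
Proof.
move=> mY mZ.
pose YR : {RV P >-> R} := HB.pack Y (isMeasurableFun.Build _ _ _ _ Y mY).
pose ZR : {RV P >-> R} := HB.pack Z (isMeasurableFun.Build _ _ _ _ Z mZ).
exact: (@RV_product YR ZR).
Qed.

End independent_product.

Section adapted.
Context (R : realType) d (Omega : measurableType d) (P : probability Omega R).
Variable W : R -> {RV P >-> R}.
Implicit Types (X Y : Omega -> R) (a b t : R).

Lemma adapted_incr a b X : a <= b ->
  measurable_wrt (wiener_filtration W a) X ->
  measurable_wrt (wiener_filtration W b) X.
Proof.
move=> ab mX B mB; apply: sub_smallest2r (mX B mB).
  exact: smallest_sigma_algebra.
apply: setSU => // _ [v [u [C [vu ua mC ->]]]].
by exists v, u, C; split => //; exact: le_trans ab.
Qed.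

Lemma adapted_cst a (r : R) : measurable_wrt (wiener_filtration W a) (fun=> r).
Proof. by apply/measurable_wrtP; exact: measurable_cst. Qed.

Lemma adaptedD a X Y :
  measurable_wrt (wiener_filtration W a) X ->
  measurable_wrt (wiener_filtration W a) Y ->
  measurable_wrt (wiener_filtration W a) (fun w => X w + Y w).
Proof.
by move=> /measurable_wrtP mX /measurable_wrtP mY; apply/measurable_wrtP;
  exact: measurable_funD.
Qed.

Lemma adaptedM a X Y :
  measurable_wrt (wiener_filtration W a) X ->
  measurable_wrt (wiener_filtration W a) Y ->
  measurable_wrt (wiener_filtration W a) (fun w => X w * Y w).
Proof.
by move=> /measurable_wrtP mX /measurable_wrtP mY; apply/measurable_wrtP;
  exact: measurable_funM.
Qed.

Lemma adapted_increment a v u : v <= u -> u <= a ->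
  measurable_wrt (wiener_filtration W a) (increment W v u).
Proof.
by move=> vu ua B mB; apply: sub_gen_smallest; left; exists v, u, B.
Qed.

Hypothesis wW : two_sided_wiener W.
Hypothesis cP : measure_is_complete P.

Lemma adapted_measurable a X :
  measurable_wrt (wiener_filtration W a) X -> measurable_fun setT X.
Proof.
move=> mX _ B mB; rewrite setTI.
by have [] := wiener_filtration_indep wW cP (lexx a) measurableT (mX B mB).
Qed.

Lemma increment_moments a b : a <= b ->
  [/\ sqint P (increment W a b), ip P (increment W a b) (fun=> 1) = 0 &
      ip P (increment W a b) (increment W a b) = b - a].
Proof.
rewrite le_eqVlt => /predU1P[<-|ab].
  have -> : increment W a a = (fun=> 0).
    by apply/funext => w; rewrite /increment subrr.
  by split; [exact: sqint0|exact: ip0l|rewrite subrr ip0l].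
have s0 : 0 < Num.sqrt (b - a) by rewrite sqrtr_gt0 subr_gt0.
case: wW => _ _ law _.
have [] := normal_moments s0 (measurable_increment W a b) (fun B => law a b B ab).
by rewrite sqr_sqrtr// subr_ge0 ltW.
Qed.

Lemma indep_adapted_increment a b Y (h : R -> R) : a <= b ->
  measurable_wrt (wiener_filtration W a) Y -> measurable_fun setT h ->
  P.-integrable setT (EFin \o Y) ->
  P.-integrable setT (fun w => (h (increment W a b w))%:E) ->
  P.-integrable setT (fun w => (Y w * h (increment W a b w))%:E) /\
  \int[P]_w (Y w * h (increment W a b w)) =
  \int[P]_w Y w * \int[P]_w h (increment W a b w).
Proof.
move=> ab aY mh iY ih; apply: independent_product => //.
- exact: adapted_measurable aY.
- by apply: measurableT_comp => //; exact: measurable_increment.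
- move=> A B mA mB.
  have mhB : measurable (h @^-1` B) by rewrite -[X in measurable X]setTI; exact: mh.
  by have [] := wiener_filtration_indep wW cP ab mhB (aY A mA).
Qed.

Lemma expectation_adapted_increment a b Y : a <= b ->
  measurable_wrt (wiener_filtration W a) Y -> P.-integrable setT (EFin \o Y) ->
  \int[P]_w (Y w * increment W a b w) = 0.
Proof.
move=> ab aY iY; have [sD D1 _] := increment_moments ab.
have iD := sqint_integrable (probability_lty P) sD.
have [] := indep_adapted_increment ab aY (@measurable_id _ _ setT) iY iD.
move=> _ ->; move: D1; rewrite /ip; under eq_Rintegral do rewrite mulr1.
by move=> ->; rewrite mulr0.
Qed.

Lemma expectation_adapted_increment_sqr a b Y : a <= b ->
  measurable_wrt (wiener_filtration W a) Y -> P.-integrable setT (EFin \o Y) ->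
  P.-integrable setT (fun w => (Y w * increment W a b w ^+ 2)%:E) /\
  \int[P]_w (Y w * increment W a b w ^+ 2) = (\int[P]_w Y w) * (b - a).
Proof.
move=> ab aY iY; have [sD _ D2] := increment_moments ab.
have [iYD ->] := @indep_adapted_increment a b Y (fun x => x ^+ 2) ab aY
  (measurable_funX 2 (@measurable_id _ _ setT)) iY sD.2.
by split => //; congr (_ * _).
Qed.

End adapted.

(** * The isometry for simple integrands *)

Section tensor_ip.
Context d1 d2 (T1 : measurableType d1) (T2 : measurableType d2) (R : realType).
Variables (m1 : {sigma_finite_measure set T1 -> \bar R})
  (m2 : {sigma_finite_measure set T2 -> \bar R}).

Lemma sqint_tensor (f : T1 -> R) (g : T2 -> R) : sqint m1 f -> sqint m2 g ->
  sqint (m1 \x m2)%E (fun z : T1 * T2 => f z.1 * g z.2).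
Proof.
move=> [mf f2] [mg g2]; split.
  apply: measurable_funM.
    by apply: measurableT_comp => //; exact: measurable_fst.
  by apply: measurableT_comp => //; exact: measurable_snd.
have [+ _] := tensor_integral f2 g2.
by apply: eq_integrable => // z _; rewrite exprMn.
Qed.

Lemma ip_tensor (f f' : T1 -> R) (g g' : T2 -> R) :
  sqint m1 f -> sqint m1 f' -> sqint m2 g -> sqint m2 g' ->
  ip (m1 \x m2)%E (fun z : T1 * T2 => f z.1 * g z.2)
     (fun z : T1 * T2 => f' z.1 * g' z.2) = ip m1 f f' * ip m2 g g'.
Proof.
move=> sf sf' sg sg'.
have [_ <-] := tensor_integral (sqint_mul sf sf') (sqint_mul sg sg').
by apply: eq_Rintegral => z _; ring.
Qed.

End tensor_ip.

Section overlap.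
Context (R : realType).
Notation leb := (@lebesgue_measure R).
Implicit Types a b : R.

Lemma sqint_indic_itv (b0 b1 : bool) a b :
  sqint leb (\1_([set` Interval (BSide b0 a) (BSide b1 b)]) : R -> R).
Proof.
split; first exact: measurable_indic.
rewrite (_ : (fun _ => _) =
    (EFin \o \1_([set` Interval (BSide b0 a) (BSide b1 b)]))); last first.
  by apply/funext => x /=; rewrite indicE; case: (_ \in _); rewrite ?expr1n ?expr0n.
exact: integrable_indic_itv.
Qed.

(** The inner product of two indicators is the length of the overlap; in this
    form the covariance of two steps is symmetric in the steps. *)
Lemma ip_indic_itv a b a' b' :
  ip leb (\1_(`]a, b]%classic) : R -> R) (\1_(`]a', b']%classic) : R -> R) =
  Num.max 0 (Num.min b b' - Num.max a a').
Proof.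
rewrite /ip; under eq_Rintegral do rewrite -[_ * _]/((\1__ \* \1__) _) -indicI.
rewrite /Rintegral integral_indic ?setIT//; last exact: measurableI.
have -> : `]a, b]%classic `&` `]a', b']%classic =
    `]Num.max a a', Num.min b b']%classic.
  apply/seteqP; split => x /=; rewrite !in_itv/= gt_max le_min.
    by move=> [/andP[-> ->] /andP[-> ->]].
  by move=> /andP[/andP[-> ->] /andP[-> ->]].
have E := lebesgue_measure_itv `]Num.max a a', Num.min b b'] : leb _ = _.
rewrite (congr1 fine E)/= lte_fin; case: ltP => h.
  by apply/esym/max_r; rewrite subr_ge0 ltW.
by apply/esym/max_l; rewrite subr_le0.
Qed.

End overlap.

Section simple_isometry.
Context (R : realType) d (Omega : measurableType d) (P : probability Omega R).
Variable W : R -> {RV P >-> R}.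
Hypothesis wW : two_sided_wiener W.
Hypothesis cP : measure_is_complete P.
Implicit Types (a b : R) (c : Omega -> R).
Notation leb := (@lebesgue_measure R).
Notation adapted a X := (measurable_wrt (wiener_filtration W a) X).
Notation bounded_fun c := (exists M : R, forall w : Omega, `|c w| <= M).
Notation step c a b := (fun w : Omega => c w * increment W a b w).

Lemma sqint_bounded_adapted a c : adapted a c -> bounded_fun c -> sqint P c.
Proof.
move=> ac [M cM]; have mc := adapted_measurable wW cP ac.
have := sqint_bounded mc cM (sqint1 P).
by congr sqint; apply/funext => w; rewrite mulr1.
Qed.

Lemma sqint_step a b c : a <= b -> adapted a c -> bounded_fun c ->
  sqint P (step c a b).
Proof.
move=> ab ac [M cM]; have mc := adapted_measurable wW cP ac.
by have [sD _ _] := increment_moments wW ab; exact: sqint_bounded cM sD.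
Qed.

Lemma adapted_step a b c : a <= b -> adapted a c -> adapted b (step c a b).
Proof.
move=> ab ac; apply: adaptedM; first exact: adapted_incr ac.
exact: adapted_increment.
Qed.

(** A step after time a is orthogonal to the past at a: its increment is
    independent of c X and has mean zero. *)
Lemma ip_step_adapted a b c X : a <= b -> adapted a c -> bounded_fun c ->
  adapted a X -> sqint P X -> ip P X (step c a b) = 0.
Proof.
move=> ab ac bc aX sX.
have sc := sqint_bounded_adapted ac bc.
rewrite -(expectation_adapted_increment wW cP ab (adaptedM aX ac) (sqint_mul sX sc)).
by apply: eq_Rintegral => w _; rewrite mulrA.
Qed.

Let ip_step_same a b b' c c' : a <= b -> b <= b' ->
  adapted a c -> bounded_fun c -> adapted a c' -> bounded_fun c' ->
  ip P (step c a b) (step c' a b') = ip P c c' * (b - a).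
Proof.
move=> ab bb' ac bc ac' bc'.
have ab' := le_trans ab bb'.
have sc := sqint_bounded_adapted ac bc.
have sc' := sqint_bounded_adapted ac' bc'.
have acD := adapted_step ab ac; have scD := sqint_step ab ac bc.
have abc' := adapted_incr bb' (adapted_incr ab ac').
have scD' := sqint_step ab ac' bc'.
have sbD' := sqint_step bb' (adapted_incr ab ac') bc'.
have -> : step c' a b' = (fun w => step c' a b w + step c' b b' w).
  by apply/funext => w; rewrite /increment; ring.
rewrite ipDr// (ip_step_adapted bb' (adapted_incr ab ac') bc' acD scD) addr0.
have [_ <-] := expectation_adapted_increment_sqr wW cP ab (adaptedM ac ac')
  (sqint_mul sc sc').
by apply: eq_Rintegral => w _; ring.
Qed.

(** Cutting the first increment at the starting point a' of the second leaves an
    orthogonal part and two increments starting at the same time. *)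
Let ip_step_ordered a b a' b' c c' : a <= b -> a' <= b' -> a <= a' ->
  adapted a c -> bounded_fun c -> adapted a' c' -> bounded_fun c' ->
  ip P (step c a b) (step c' a' b') =
  ip P c c' * Num.max 0 (Num.min b b' - a').
Proof.
move=> ab a'b' aa' ac bc ac' bc'.
have [ba'|a'b] := leP b a'.
  rewrite max_l; last by rewrite subr_le0 ge_min ba'.
  rewrite mulr0 ip_step_adapted//; last exact: sqint_step.
  exact: adapted_incr ba' (adapted_step ab ac).
have a'b_ := ltW a'b.
have a'c := adapted_incr aa' ac.
rewrite max_r ?subr_ge0 ?le_min ?a'b_//.
have -> : step c a b = (fun w => step c a a' w + step c a' b w).
  by apply/funext => w; rewrite /increment; ring.
rewrite ipDl//; [|exact: sqint_step..].
rewrite (ip_step_adapted a'b' ac' bc' (adapted_step aa' ac) (sqint_step aa' ac bc)).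
rewrite add0r; have [bb'|b'b] := leP b b'; first exact: ip_step_same.
by rewrite ipC (ip_step_same a'b' (ltW b'b))// ipC.
Qed.

Lemma ip_step a b a' b' c c' : a <= b -> a' <= b' ->
  adapted a c -> bounded_fun c -> adapted a' c' -> bounded_fun c' ->
  ip P (step c a b) (step c' a' b') =
  ip leb (\1_(`]a, b]%classic) : R -> R) (\1_(`]a', b']%classic) : R -> R) *
  ip P c c'.
Proof.
move=> ab a'b' ac bc ac' bc'; rewrite ip_indic_itv mulrC.
have [aa'|a'a] := leP a a'; first exact: ip_step_ordered.
by rewrite ipC (ip_step_ordered a'b' ab (ltW a'a))// ipC minC.
Qed.

Notation lebP := (leb \x P)%E.

(** The simple process as a function on time times chance: the isometry sends it
    to its stochastic integral. *)
Definition sp_fun a b (S : simple_process W a b) (z : measurableTypeR R * Omega) : R :=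
  sp_value S z.1 z.2.

Let sp_term a b (S : simple_process W a b) i (w : Omega) :=
  sp_coef S i w * increment W (sp_time S i) (sp_time S i.+1) w.
Let sp_fun_term a b (S : simple_process W a b) i (z : measurableTypeR R * Omega) : R :=
  \1_(`]sp_time S i, sp_time S i.+1]%classic) z.1 * sp_coef S i z.2.

Let sqint_sp_term a b (S : simple_process W a b) i : (i < sp_size S)%N ->
  sqint P (sp_term S i).
Proof.
move=> iS; apply: sqint_step; first exact: sp_time_le.
- exact: sp_coef_adapted.
- exact: sp_coef_bounded.
Qed.

Let sqint_sp_fun_term a b (S : simple_process W a b) i : (i < sp_size S)%N ->
  sqint lebP (sp_fun_term S i).
Proof.
move=> iS; apply: sqint_tensor; first exact: sqint_indic_itv.
exact: sqint_bounded_adapted (sp_coef_adapted iS) (sp_coef_bounded iS).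
Qed.

Let sp_funE a b (S : simple_process W a b) :
  sp_fun S = (fun z => \sum_(i < sp_size S) sp_fun_term S i z).
Proof.
by apply/funext => z; apply: eq_bigr => i _; rewrite mulrC.
Qed.

Lemma sqint_sp_integral a b (S : simple_process W a b) : sqint P (sp_integral S).
Proof. by apply: (@sqint_sum _ _ _ P _ (sp_term S)) => i iS; exact: sqint_sp_term. Qed.

Lemma sqint_sp_fun a b (S : simple_process W a b) : sqint lebP (sp_fun S).
Proof.
rewrite sp_funE; apply: (@sqint_sum _ _ _ _ _ (sp_fun_term S)) => i iS.
exact: sqint_sp_fun_term.
Qed.

(** Both sides are bilinear in the steps, so it suffices to compare two steps;
    the two processes may have unrelated partitions and different horizons. *)
Theorem simple_ito_isometry a b a' b' (S : simple_process W a b)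
    (S' : simple_process W a' b') :
  ip P (sp_integral S) (sp_integral S') = ip lebP (sp_fun S) (sp_fun S').
Proof.
have sS' := sqint_sp_integral S'; have sfS' := sqint_sp_fun S'.
rewrite (ip_suml (@sqint_sp_term _ _ S) sS').
rewrite [in RHS]sp_funE (ip_suml (@sqint_sp_fun_term _ _ S) sfS').
apply: eq_bigr => i _.
have si := sqint_sp_term (ltn_ord i); have sfi := sqint_sp_fun_term (ltn_ord i).
rewrite ipC (ip_suml (@sqint_sp_term _ _ S') si).
rewrite [in RHS]ipC sp_funE (ip_suml (@sqint_sp_fun_term _ _ S') sfi).
apply: eq_bigr => j _; rewrite ip_step//.
- rewrite ip_tensor//; [exact: sqint_indic_itv|exact: sqint_indic_itv| |].
  + exact: sqint_bounded_adapted (sp_coef_adapted (ltn_ord j)) (sp_coef_bounded (ltn_ord j)).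
  + exact: sqint_bounded_adapted (sp_coef_adapted (ltn_ord i)) (sp_coef_bounded (ltn_ord i)).
- exact: sp_time_le.
- exact: sp_time_le.
- exact: sp_coef_adapted.
- exact: sp_coef_bounded.
- exact: sp_coef_adapted.
- exact: sp_coef_bounded.
Qed.

Lemma ip_sp_integral_adapted a b (S : simple_process W a b) X :
  adapted a X -> sqint P X -> ip P X (sp_integral S) = 0.
Proof.
move=> aX sX; rewrite ipC (ip_suml (@sqint_sp_term _ _ S) sX) big1// => i _.
have at_ k : (k <= sp_size S)%N -> a <= sp_time S k.
  elim: k => [_|k ih kS]; first by rewrite sp_time_first.
  exact: le_trans (ih (ltnW kS)) (sp_time_le kS).
rewrite ipC ip_step_adapted//; first exact: sp_time_le.
- exact: sp_coef_adapted.
- exact: sp_coef_bounded.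
- by apply: adapted_incr aX; apply: at_; exact: ltnW.
Qed.

Lemma sp_value_out a b (S : simple_process W a b) u w :
  ~~ (a <= u <= b) -> sp_value S u w = 0.
Proof.
move=> uab; rewrite /sp_value big1// => i _.
have mono k l : (k <= l <= sp_size S)%N -> sp_time S k <= sp_time S l.
  elim: l => [|l ih] /andP[]; first by rewrite leqn0 => /eqP->.
  rewrite leq_eqVlt ltnS => /predU1P[->//|kl lS].
  by apply: le_trans (sp_time_le lS); apply: ih; rewrite kl ltnW.
rewrite indicE memNset ?mulr0//= in_itv/= => /andP[iu ui].
move/negP: uab; apply; apply/andP; split.
  have := mono 0%N i; rewrite sp_time_first leq0n (ltnW (ltn_ord i)).
  by move=> /(_ isT) ai; exact: le_trans ai (ltW iu).
have := mono i.+1 (sp_size S); rewrite sp_time_last leqnn ltn_ord.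
by move=> /(_ isT); exact: le_trans.
Qed.

End simple_isometry.

(** * The isometry for Ito integrals, and pairing with the drift *)

Section ito.
Context (R : realType) d (Omega : measurableType d) (P : probability Omega R).
Notation leb := (@lebesgue_measure R).
Notation lebP := (leb \x P)%E.
Implicit Types (a b : R) (H : R -> Omega -> R).

(** Extending by zero outside [a, b] lets integrals with different horizons be
    compared in one Hilbert space. *)
Definition on_itv a b H (z : measurableTypeR R * Omega) : R :=
  \1_(`[a, b]%classic) z.1 * H z.1 z.2.

Definition itv_measurable a b H :=
  measurable_fun (`[a, b]%classic `*` [set: Omega])
    (fun z : measurableTypeR R * Omega => H z.1 z.2).

Lemma measurable_on_itv a b H : itv_measurable a b H ->
  measurable_fun setT (on_itv a b H).
Proof.
move=> mH.
have mD : measurable (`[a, b]%classic `*` [set: Omega] :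
    set (measurableTypeR R * Omega)) by exact: measurableX.
have := (measurable_restrictT _ mD).1 mH.
congr measurable_fun; apply/funext => z; rewrite patch_indic /on_itv /= mulrC.
congr (_ * _); rewrite !indicE; congr (_%:R); congr nat_of_bool.
by apply/idP/idP; rewrite !inE; [case|split].
Qed.

Lemma itv_measurableB a b H H' : itv_measurable a b H -> itv_measurable a b H' ->
  itv_measurable a b (fun u w => H u w - H' u w).
Proof. by move=> mH mH'; exact: measurable_funB. Qed.

Lemma integral_on_itv_sqr a b H : itv_measurable a b H ->
  (\int[lebP]_z ((on_itv a b H z) ^+ 2)%:E =
   \int[leb]_(u in `[a, b]) 'E_P[fun w => (H u w ^+ 2)%R])%E.
Proof.
move=> mH; have mG := measurable_on_itv mH.
rewrite fubini_tonelli1; last 2 first.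
- by apply/measurable_EFinP; exact: measurable_funX.
- by move=> z; rewrite lee_fin sqr_ge0.
rewrite [RHS]integral_mkcond; apply: eq_integral => u _.
rewrite /fubini_F patchE unlock /on_itv/=; case: ifPn => [uab|uab].
  by apply: eq_integral => w _; rewrite indicE uab mul1r.
rewrite integral0_eq// => w _.
by rewrite indicE (negbTE uab) mul0r expr0n.
Qed.

Lemma sqint_on_itv a b H : itv_measurable a b H ->
  (\int[leb]_(u in `[a, b]) 'E_P[fun w => (H u w ^+ 2)%R] < +oo)%E ->
  sqint lebP (on_itv a b H).
Proof.
move=> mH fH; have mG := measurable_on_itv mH; split => //.
apply/integrableP; split.
  by apply/measurable_EFinP; exact: measurable_funX.
under eq_integral do rewrite /= ger0_norm ?sqr_ge0//.
by rewrite integral_on_itv_sqr.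
Qed.

Variable W : R -> {RV P >-> R}.
Hypothesis wW : two_sided_wiener W.
Hypothesis cP : measure_is_complete P.

Let itv_measurable_sp a b (S : simple_process W a b) :
  itv_measurable a b (sp_value S).
Proof. by case: (sqint_sp_fun wW cP S) => mS _; exact: measurable_funTS. Qed.

Let on_itvB_sp a b H (S : simple_process W a b) :
  (fun z => on_itv a b H z - sp_fun S z) =
  on_itv a b (fun u w => H u w - sp_value S u w).
Proof.
apply/funext => -[u w]; rewrite /on_itv /sp_fun/= indicE.
have [uab|uab] := boolP (u \in _); first by rewrite !mul1r.
rewrite !mul0r sp_value_out ?subr0//.
by apply: contra uab => uab; rewrite inE/= in_itv.
Qed.

Lemma ip_ito_integral_adapted a b H I X : is_ito_integral W a b H I ->
  measurable_wrt (wiener_filtration W a) X -> sqint P X -> ip P X I = 0.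
Proof.
move=> [_ LI [S [_ SI]]] aX sX; have sI := sqint_Lfun LI.
have sS k := sqint_sp_integral wW cP (S k).
have c1 : ip P (fun w => I w - sp_integral (S k) w)
    (fun w => I w - sp_integral (S k) w) @[k --> \oo] --> (0:R).
  move/fine_cvg : SI; apply: cvg_trans; apply: near_eq_cvg; apply: nearW => k.
  by rewrite ip_expectation /= unlock.
have := ip_cvg0 (fun k => sqintB sI (sS k)) sX c1.
under eq_fun do rewrite ipC (ipBr sI (sS _) sX)
  (ip_sp_integral_adapted wW cP _ aX sX) subr0.
by move=> h; apply: (cvg_unique _ (cvg_cst _) h).
Qed.

(** Both sides of [simple_ito_isometry] converge along approximating
    sequences of the two integrands. *)
Theorem ito_isometry a b a' b' H H' I I' :
  is_ito_integral W a b H I -> is_ito_integral W a' b' H' I' ->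
  ip P I I' = ip lebP (on_itv a b H) (on_itv a' b' H').
Proof.
have approx a0 b0 H0 I0 : is_ito_integral W a0 b0 H0 I0 ->
  exists S : nat -> simple_process W a0 b0, [/\ sqint P I0,
    sqint lebP (on_itv a0 b0 H0),
    ip P (fun w => I0 w - sp_integral (S k) w)
      (fun w => I0 w - sp_integral (S k) w) @[k --> \oo] --> (0:R) &
    ip lebP (fun z => on_itv a0 b0 H0 z - sp_fun (S k) z)
      (fun z => on_itv a0 b0 H0 z - sp_fun (S k) z) @[k --> \oo] --> (0:R)].
  move=> [[mH _ fH] LI [S [SH SI]]]; exists S; split.
  - exact: sqint_Lfun.
  - exact: sqint_on_itv.
  - move/fine_cvg : SI; apply: cvg_trans; apply: near_eq_cvg; apply: nearW => k.
    by rewrite ip_expectation /= unlock.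
  - move/fine_cvg : SH; apply: cvg_trans; apply: near_eq_cvg; apply: nearW => k.
    rewrite on_itvB_sp ip_expectation integral_on_itv_sqr//.
    by apply: itv_measurableB.
move=> /approx[S [sI sH SI SH]] /approx[S' [sI' sH' SI' SH']].
have c1 := ip_cvg sI sI' (fun k => sqint_sp_integral wW cP (S k))
  (fun k => sqint_sp_integral wW cP (S' k)) SI SI'.
have c2 := ip_cvg sH sH' (fun k => sqint_sp_fun wW cP (S k))
  (fun k => sqint_sp_fun wW cP (S' k)) SH SH'.
move: c1; under eq_fun do rewrite (simple_ito_isometry wW cP).
by move=> c1; exact: cvg_unique c1 c2.
Qed.

(** The covariance of the integral at two times only sees the common part
    [a, b] of the time intervals, as for any square-integrable martingale. *)
Lemma ito_covariance a b b' H I I' : b <= b' ->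
  is_ito_integral W a b H I -> is_ito_integral W a b' H I' ->
  ip P I I' = fine (\int[leb]_(u in `[a, b]) 'E_P[fun w => (H u w ^+ 2)%R])%E.
Proof.
move=> bb' iI iI'; rewrite (ito_isometry iI iI').
have [mH _ _] : ito_integrand W a b H by case: iI.
rewrite -(integral_on_itv_sqr mH) -ip_expectation.
apply: eq_Rintegral => -[u w] _; rewrite /on_itv/= !indicE.
have [uab|uab] := boolP (u \in `[a, b]%classic); last by rewrite !mul0r.
suff -> : u \in `[a, b']%classic by [].
move: uab; rewrite !inE/= !in_itv/= => /andP[-> ub].
exact: le_trans ub bb'.
Qed.

End ito.

Section pairing.
Context (R : realType) d (Omega : measurableType d) (P : probability Omega R).
Notation leb := (@lebesgue_measure R).
Notation lebP := (leb \x P)%E.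
Implicit Types (a b : R) (H : R -> Omega -> R) (G : Omega -> R).

(** For almost every w the section u |-> h (u, w) is integrable, so that G w can
    be moved inside the time integral; Fubini does the rest. *)
Lemma fubini_pairing (h : measurableTypeR R * Omega -> R) (G D : Omega -> R) :
  lebP.-integrable setT (fun z => (h z)%:E) ->
  lebP.-integrable setT (fun z => (G z.2 * h z)%:E) ->
  measurable_fun setT G -> measurable_fun setT D ->
  {ae P, forall w, D w = \int[leb]_u h (u, w)} ->
  \int[P]_w (G w * D w) =
  fine (\int[leb]_u \int[P]_w (G w * h (u, w))%:E)%E.
Proof.
move=> ih iGh mG mD aeD; rewrite /Rintegral; congr fine.
rewrite (Fubini iGh); apply: ae_eq_integral => //.
- by apply/measurable_EFinP; exact: measurable_funM.
- exact: measurable_fubini_G iGh.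
have := ae_integrable2 ih.
apply: filterS2 aeD => w Dw ihw _ /=.
rewrite Dw EFinM /Rintegral fineK; last exact: integrable_fin_num.
by rewrite -integralZl.
Qed.

Let integrable_pair a b H G : sqint lebP (on_itv a b H) -> sqint P G ->
  lebP.-integrable setT (fun z => (G z.2 * on_itv a b H z)%:E).
Proof.
move=> sH sG.
have := sqint_mul (sqint_tensor (sqint_indic_itv true false a b) sG) sH.
apply: eq_integrable => // -[u w] _; rewrite /on_itv/=; congr EFin.
by rewrite indicE; case: (_ \in _); rewrite ?mul1r// !mul0r mulr0.
Qed.

Lemma integrable_ip a b H G : sqint lebP (on_itv a b H) -> sqint P G ->
  (forall u, a <= u <= b -> sqint P (H u)) ->
  leb.-integrable `[a, b] (fun u => (ip P G (H u))%:E).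
Proof.
move=> sH sG sHu.
have iF := integrable_fubini_F (integrable_pair sH sG).
have mI : measurable (`[a, b]%classic : set (measurableTypeR R)).
  exact: measurable_itv.
have := integrableS measurableT mI (@subsetT _ _) iF.
apply: eq_integrable => // u uab; rewrite /fubini_F/= /on_itv/=.
have uab' : a <= u <= b by move: uab; rewrite inE/= in_itv.
rewrite /ip /Rintegral fineK; last first.
  by apply: integrable_fin_num => //; exact: sqint_mul (sHu u uab').
by apply: eq_integral => w _; rewrite indicE uab mul1r.
Qed.

(** Pairing with a fixed G turns the pathwise drift into a deterministic
    integral. *)
Lemma ip_drift a b H (c : R -> R) (k : R) G (D : Omega -> R) :
  sqint lebP (on_itv a b H) -> sqint P G -> sqint P D ->
  (forall u, a <= u <= b -> sqint P (H u)) ->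
  leb.-integrable `[a, b] (fun u => (c u)%:E) ->
  {ae P, forall w, D w = \int[leb]_(u in `[a, b]) (k * H u w + c u)} ->
  ip P G D = k * \int[leb]_(u in `[a, b]) ip P G (H u) +
    (\int[leb]_(u in `[a, b]) c u) * \int[P]_w G w.
Proof.
move=> sH sG sD sHu ic aeD.
pose h (z : measurableTypeR R * Omega) : R :=
  k * on_itv a b H z + (\1_(`[a, b]%classic) z.1 * c z.1) * 1.
have mI : measurable (`[a, b]%classic : set (measurableTypeR R)).
  exact: measurable_itv.
have ic' : leb.-integrable setT (fun u => (\1_(`[a, b]%classic) u * c u)%:E).
  have := (integrable_mkcond _ mI).1 ic.
  apply: eq_integrable => // u _; rewrite patchE indicE.
  by case: ifP => _; rewrite ?mul1r// mul0r.
have iG := sqint_integrable (probability_lty P) sG.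
have [ic1 _] := tensor_integral ic' (sqint_integrable (probability_lty P) (sqint1 P)).
have [icG _] := tensor_integral ic' iG.
have iH1 : lebP.-integrable setT (fun z => (on_itv a b H z)%:E).
  have := integrable_pair sH (sqint1 P).
  by apply: eq_integrable => // z _; rewrite mul1r.
have ih : lebP.-integrable setT (fun z => (h z)%:E).
  have := integrableD measurableT (integrableZl measurableT k iH1) ic1.
  by apply: eq_integrable.
have iGh : lebP.-integrable setT (fun z => (G z.2 * h z)%:E).
  have := integrableD measurableT
    (integrableZl measurableT k (integrable_pair sH sG)) icG.
  apply: eq_integrable => // z _; rewrite /h /= -EFinM -EFinD; congr EFin; ring.
rewrite /ip (@fubini_pairing h G D)//; [|by case: sG|by case: sD|]; last first.
  apply: filterS aeD => w ->; rewrite Rintegral_mkcond.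
  apply: eq_Rintegral => u _; rewrite patch_indic /h /on_itv/=.
  by move: (\1__ _) => i; ring.
have ii := integrable_ip sH sG sHu.
transitivity (\int[leb]_(u in `[a, b]) (k * ip P G (H u) + c u * \int[P]_w G w)).
  rewrite /Rintegral; congr fine; rewrite [RHS]integral_mkcond.
  apply: eq_integral => u _; rewrite /h /on_itv/= patchE.
  case: ifPn => uab; last first.
    rewrite integral0_eq// => w _.
    by rewrite !indicE (negbTE uab) !mul0r !mulr0 addr0 mulr0.
  have uab' : a <= u <= b by move: uab; rewrite inE/= in_itv.
  have iGH := sqint_mul sG (sHu u uab').
  transitivity (\int[P]_w (k%:E * (G w * H u w)%:E + (c u)%:E * (G w)%:E))%E.
    apply: eq_integral => w _; rewrite !indicE uab !mul1r mulr1.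
    by rewrite -!EFinM -EFinD; congr EFin; ring.
  rewrite integralD//; [|exact: integrableZl..].
  rewrite !integralZl// /ip /Rintegral EFinD !EFinM !fineK//.
  - exact: integrable_fin_num.
  - exact: integrable_fin_num.
rewrite RintegralD//; last 2 first.
- by have := integrableZl mI k ii; exact: eq_integrable.
- have := integrableZr mI (\int[P]_w G w) ic.
  exact: eq_integrable.
by rewrite RintegralZl// RintegralZr.
Qed.

End pairing.

(** * Linear differential and Volterra equations on a segment *)

Section interval_calculus.
Context (R : realType).
Notation leb := (@lebesgue_measure R).
Implicit Types (a b x t k : R) (f g F G : R -> R).

Definition itv_integrable a b f := leb.-integrable `[a, b] (EFin \o f).

Let mI a b : measurable (`[a, b]%classic : set (measurableTypeR R)).
Proof. exact: measurable_itv. Qed.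

Lemma itv_integrableS a b a' b' f : a <= a' -> b' <= b ->
  itv_integrable a b f -> itv_integrable a' b' f.
Proof.
move=> aa' b'b; apply: integrableS => //.
by apply: subset_itv; rewrite bnd_simp.
Qed.

Lemma itv_integrableZ a b k f : itv_integrable a b f ->
  itv_integrable a b (fun x => k * f x).
Proof.
move=> intf; have := integrableZl (mI a b) k intf.
by apply: eq_integrable.
Qed.

Lemma itv_integrableB a b f g : itv_integrable a b f -> itv_integrable a b g ->
  itv_integrable a b (fun x => f x - g x).
Proof.
move=> intf intg; have := integrableB (mI a b) intf intg.
by apply: eq_integrable.
Qed.

Lemma itv_integrable_continuous a b f : {within `[a, b], continuous f} ->
  itv_integrable a b f.
Proof. by apply: continuous_compact_integrable; exact: segment_compact. Qed.

Lemma eq_itv_integrable a b f g : (forall x, a <= x <= b -> f x = g x) ->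
  itv_integrable a b f -> itv_integrable a b g.
Proof.
move=> fg; apply: eq_integrable => // x; rewrite inE/= in_itv/= => xab.
by rewrite /= fg.
Qed.

Lemma eq_itv_integral a b f g : (forall x, a <= x <= b -> f x = g x) ->
  \int[leb]_(x in `[a, b]) f x = \int[leb]_(x in `[a, b]) g x.
Proof.
by move=> fg; apply: eq_Rintegral => x; rewrite inE/= in_itv/= => /fg.
Qed.

Lemma eq_within a b f g : (forall x, a <= x <= b -> f x = g x) ->
  {within `[a, b], continuous f} -> {within `[a, b], continuous g}.
Proof.
move=> fg; apply: subspace_eq_continuous => x.
by rewrite inE/= in_itv/= => /fg.
Qed.

Lemma withinW a b a' b' f : a <= a' -> b' <= b ->
  {within `[a, b], continuous f} -> {within `[a', b'], continuous f}.
Proof.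
move=> aa' b'b; apply: continuous_subspaceW.
by apply: subset_itv; rewrite bnd_simp.
Qed.

Lemma withinD a b f g : {within `[a, b], continuous f} ->
  {within `[a, b], continuous g} -> {within `[a, b], continuous (fun x => f x + g x)}.
Proof. by move=> cf cg x; apply: cvgD; [exact: cf|exact: cg]. Qed.

Lemma withinM a b f g : {within `[a, b], continuous f} ->
  {within `[a, b], continuous g} -> {within `[a, b], continuous (fun x => f x * g x)}.
Proof. by move=> cf cg x; apply: cvgM; [exact: cf|exact: cg]. Qed.

Lemma withinZ a b k f : {within `[a, b], continuous f} ->
  {within `[a, b], continuous (fun x => k * f x)}.
Proof. by move=> cf x; apply: cvgM; [exact: cvg_cst|exact: cf]. Qed.

Lemma within_expR a b k s :
  {within `[a, b], continuous (fun x => expR (k * (x - s)))}.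
Proof.
apply: continuous_subspaceT => x.
apply: (@continuous_comp _ _ _ (fun x => k * (x - s)) expR); last exact: continuous_expR.
by apply: cvgM; [exact: cvg_cst|apply: cvgB; [exact: cvg_id|exact: cvg_cst]].
Qed.

Lemma within_interior a b f x : a < x < b -> {within `[a, b], continuous f} ->
  {for x, continuous f}.
Proof.
move=> /andP[ax xb] /(continuous_within_itvP _ (lt_trans ax xb))[+ _ _].
by apply; rewrite in_itv/= ax xb.
Qed.

Lemma within_integral a b f : a <= b -> itv_integrable a b f ->
  {within `[a, b], continuous (fun t => \int[leb]_(x in `[a, t]) f x)}.
Proof. exact: parameterized_integral_continuous. Qed.

Lemma is_derive_integral a b f x : a < x < b ->
  {within `[a, b], continuous f} ->
  is_derive x 1 (fun t => \int[leb]_(x in `[a, t]) f x) (f x).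
Proof.
move=> axb cf; have cfx := within_interior axb cf; case/andP: axb => ax xb.
have [] := continuous_FTC1_closed xb (itv_integrable_continuous cf) ax cfx.
by rewrite derive1E => dF F'; exact: (DeriveDef dF F').
Qed.

Lemma eq_is_derive a b F G x df : a < x < b ->
  (forall t, a <= t <= b -> F t = G t) ->
  is_derive x 1 F df -> is_derive x 1 G df.
Proof.
move=> /andP[ax xb] FG; apply: near_eq_is_derive.
near=> t; apply: FG; apply/andP; split; apply: ltW; near: t.
  exact: lt_nbhsr.
exact: lt_nbhsl.
Unshelve. all: by end_near. Qed.

Lemma is_derive_expR_affine k s x :
  is_derive x 1 (fun t : R => expR (k * (t - s))) (k * expR (k * (x - s))).
Proof.
have d1 : is_derive x 1 (fun t : R => k * (t - s)) k.
  by apply: is_derive_eq; rewrite /GRing.scale/= !(mulr1,oppr0,addr0).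
apply: is_derive_eq (is_derive1_comp (is_derive_expR _) d1) _.
by rewrite /GRing.scale/= mulrC.
Qed.

(** The difference of two solutions, multiplied by e^{-k (x - a)}, has zero
    derivative. *)
Lemma ode_unique a b k F G (g : R -> R) :
  {within `[a, b], continuous F} -> {within `[a, b], continuous G} ->
  (forall x, a < x < b -> is_derive x 1 F (k * F x + g x)) ->
  (forall x, a < x < b -> is_derive x 1 G (k * G x + g x)) ->
  F a = G a -> forall t, a <= t <= b -> F t = G t.
Proof.
move=> cF cG dF dG FGa t /andP[at_ tb].
move: at_; rewrite le_eqVlt => /predU1P[<-//|at_].
pose D x := expR (- k * (x - a)) * (F x - G x).
have dD x : x \in `]a, t[ -> is_derive x 1 D (cst 0 x).
  rewrite in_itv/= => /andP[ax xt].
  have axb : a < x < b by rewrite ax (lt_le_trans xt tb).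
  have dFx := dF x axb; have dGx := dG x axb.
  have dE := is_derive_expR_affine (- k) a x.
  by apply: is_derive_eq; rewrite /GRing.scale/=; ring.
have cD : {within `[a, t], continuous D}.
  apply: withinM; first exact: within_expR.
  apply: withinD; first exact: withinW cF.
  have := withinZ (k := -1) (withinW (lexx a) tb cG).
  by apply: eq_within => x _; rewrite mulN1r.
have [c _] := MVT at_ dD cD.
have Da : D a = 0 by rewrite /D FGa (subrr (G a)) mulr0.
rewrite /cst mul0r Da subr0 => /eqP.
by rewrite mulf_eq0 expR_eq0/= subr_eq0 => /eqP.
Qed.

Lemma ode_exp a b k F : {within `[a, b], continuous F} ->
  (forall x, a < x < b -> is_derive x 1 F (k * F x)) ->
  forall t, a <= t <= b -> F t = F a * expR (k * (t - a)).
Proof.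
move=> cF dF; apply: (@ode_unique a b k F (fun t => F a * expR (k * (t - a))) (cst 0)).
- exact: cF.
- by apply: withinZ; exact: within_expR.
- by move=> x /dF; rewrite addr0.
- move=> x _; have dE := is_derive_expR_affine k a x.
  by apply: is_derive_eq; rewrite /GRing.scale/=; ring.
- by rewrite subrr mulr0 expR0 mulr1.
Qed.

(** An integrable solution is continuous, because its right-hand side is, hence
    differentiable by the fundamental theorem of calculus. *)
Lemma volterra_exp a b k c f : itv_integrable a b f ->
  (forall t, a <= t <= b -> f t = c + k * \int[leb]_(x in `[a, t]) f x) ->
  forall t, a <= t <= b -> f t = c * expR (k * (t - a)).
Proof.
move=> intf fE t tab; have ab : a <= b by case/andP: tab => /le_trans; apply.
have cf : {within `[a, b], continuous f}.
  apply: (@eq_within _ _ (fun t => c + k * \int[leb]_(x in `[a, t]) f x)).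
    by move=> x /fE.
  apply: withinD; first by apply: continuous_subspaceT => x; exact: cvg_cst.
  by apply: withinZ; exact: within_integral.
have df x : a < x < b -> is_derive x 1 f (k * f x).
  move=> axb; apply: (@eq_is_derive a b
      (fun t => c + k * \int[leb]_(x in `[a, t]) f x)) => //.
    by move=> ? /fE.
  have dI := is_derive_integral axb cf.
  by apply: is_derive_eq; rewrite /GRing.scale/=; ring.
by rewrite (ode_exp cf df tab) (fE a) ?lexx// set_itv1 Rintegral_set1 mulr0 addr0.
Qed.

(** The difference of two solutions solves the homogeneous equation, whose only
    solution is zero by [volterra_exp]. *)
Lemma volterra_unique a b k f1 f2 (g : R -> R) :
  itv_integrable a b f1 -> itv_integrable a b f2 ->
  (forall t, a <= t <= b -> f1 t = g t + k * \int[leb]_(x in `[a, t]) f1 x) ->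
  (forall t, a <= t <= b -> f2 t = g t + k * \int[leb]_(x in `[a, t]) f2 x) ->
  forall t, a <= t <= b -> f1 t = f2 t.
Proof.
move=> i1 i2 E1 E2 t tab; apply/eqP; rewrite -subr_eq0; apply/eqP.
rewrite (@volterra_exp a b k 0 _ (itv_integrableB i1 i2)) ?mul0r//.
move=> x /andP[ax xb]; rewrite RintegralB//.
- by rewrite E1 ?ax// E2 ?ax//; ring.
- exact: itv_integrableS xb i1.
- exact: itv_integrableS xb i2.
Qed.

Lemma integral_split a q t f : a <= q -> q <= t -> itv_integrable a t f ->
  \int[leb]_(x in `[a, t]) f x =
  \int[leb]_(x in `[a, q]) f x + \int[leb]_(x in `[q, t]) f x.
Proof.
move=> aq qt intf; apply/eqP; rewrite addrC -subr_eq; apply/eqP.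
rewrite (Rintegral_itvB intf) ?bnd_simp//.
rewrite Rintegral_itv_obnd_cbnd//.
by apply: integrableS intf => //; apply: subset_itv; rewrite bnd_simp.
Qed.

End interval_calculus.

(** * The covariance equations *)

Section covariance_system.
Context (R : realType).
Notation leb := (@lebesgue_measure R).
Variables (a b al v0 : R) (y m : R -> R) (L C : R -> R -> R).
Hypothesis ab : a <= b.
Hypothesis iy : itv_integrable a b y.
Hypothesis cm : {within `[a, b], continuous m}.
Hypothesis iL : forall q, a <= q <= b -> itv_integrable a b (L q).
Hypothesis iC : forall q, a <= q <= b -> itv_integrable a b (C q).

Let V t := \int[leb]_(x in `[a, t]) y x.

(** In the application L q t = Cov(N_q, Z_t), C q t = Cov(Z_q, Z_t),
    m t = E Z_t and y t = E[Z_t^2]; V is the variance of N. *)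
Hypothesis LE : forall q t, a <= q <= b -> a <= t <= b ->
  L q t = V (Num.min q t) + al * \int[leb]_(x in `[a, t]) L q x.
Hypothesis CE : forall q t, a <= q <= b -> a <= t <= b ->
  C q t = (v0 * expR (al * (q - a)) + L t q) +
          al * \int[leb]_(x in `[a, t]) C q x.
Hypothesis yE : forall t, a <= t <= b -> y t = C t t + m t ^+ 2.

Let l := L b.
Let bb : a <= b <= b. Proof. by rewrite ab lexx. Qed.

Let lE t : a <= t <= b -> l t = V t + al * \int[leb]_(x in `[a, t]) l x.
Proof. by move=> tab; rewrite /l (LE bb tab) min_r//; case/andP: tab. Qed.

(** Up to time q, the equation of L q no longer involves q. *)
Let L_before q t : q <= b -> a <= t <= q -> L q t = l t.
Proof.
move=> qb /andP[at_ tq].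
have qab : a <= q <= b by rewrite (le_trans at_ tq).
have S x : a <= x <= q -> a <= x <= b.
  by move=> /andP[-> /le_trans]; apply.
apply: (@volterra_unique _ a q al _ _ V); last by rewrite at_.
- exact: itv_integrableS (lexx a) qb (iL qab).
- exact: itv_integrableS (lexx a) qb (iL bb).
- by move=> x xaq; rewrite (LE qab (S x xaq)) min_r//; case/andP: xaq.
- by move=> x /S/lE.
Qed.

(** After time q, V (min q t) is constant and L q relaxes freely. *)
Let L_after q t : a <= q -> q <= t -> t <= b ->
  L q t = l q * expR (al * (t - q)).
Proof.
move=> aq qt tb.
have qab : a <= q <= b by rewrite aq (le_trans qt tb).
apply: (@volterra_exp _ q b al); last by rewrite qt.
  exact: itv_integrableS aq (lexx b) (iL qab).
move=> x /andP[qx xb].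
have xab : a <= x <= b by rewrite (le_trans aq qx).
rewrite (LE qab xab) (integral_split aq qx); last first.
  exact: itv_integrableS (lexx a) xb (iL qab).
rewrite min_l// -(@L_before q q) ?aq ?lexx//; last by case/andP: qab.
by rewrite (LE qab qab) minxx; ring.
Qed.

(** Rescaling removes the dependence on q from the equation of C q on [a, q]:
    there L t q is e^{al (q - t)} l t by [L_after]. *)
Let D q t := expR (- al * (q - a)) * C q t.

Let DE q t : q <= b -> a <= t <= q ->
  D q t = (v0 + expR (- al * (t - a)) * l t) +
          al * \int[leb]_(x in `[a, t]) D q x.
Proof.
move=> qb /andP[at_ tq].
have aq := le_trans at_ tq.
have qab : a <= q <= b by rewrite aq.
have tab : a <= t <= b by rewrite at_ (le_trans tq).
rewrite /D RintegralZl//; last by have := itv_integrableS (lexx a) (le_trans tq qb) (iC qab).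
rewrite (CE qab tab) (L_after at_ tq qb).
have e1 : expR (- al * (q - a)) * expR (al * (q - a)) = 1.
  by rewrite -expRD mulNr addNr expR0.
have e2 : expR (- al * (q - a)) * expR (al * (q - t)) = expR (- al * (t - a)).
  by rewrite -expRD; congr expR; ring.
set I := \int[_]_(_ in _) _; set E := expR (- al * (q - a)) in e1 e2 *.
transitivity (v0 * (E * expR (al * (q - a))) +
  (E * expR (al * (q - t))) * l t + al * (E * I)); first by ring.
by rewrite e1 e2 mulr1.
Qed.

Let iD q : a <= q <= b -> itv_integrable a b (D q).
Proof. by move=> /iC; exact: itv_integrableZ. Qed.

Let D_indep q t : q <= b -> a <= t <= q -> D q t = D b t.
Proof.
move=> qb taq; have qab : a <= q <= b.
  by rewrite qb andbT; case/andP: taq => at_ tq; exact: le_trans at_ tq.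
apply: (@volterra_unique _ a q al _ _ (fun t => v0 + expR (- al * (t - a)) * l t)) taq.
- exact: itv_integrableS (lexx a) qb (iD qab).
- exact: itv_integrableS (lexx a) qb (iD bb).
- by move=> x; exact: DE.
- by move=> x /andP[ax xq]; apply: DE => //; rewrite ax (le_trans xq).
Qed.

(** The diagonal of C is therefore a multiple of one function of one variable,
    which solves a single Volterra equation. *)
Let vE t : a <= t <= b -> C t t = expR (al * (t - a)) * D b t.
Proof.
move=> /andP[at_ tb]; rewrite -(D_indep tb) ?at_ ?lexx// /D mulrA -expRD.
by rewrite mulNr addrN expR0 mul1r.
Qed.

Let cV : {within `[a, b], continuous V}.
Proof. exact: within_integral. Qed.

Let cl : {within `[a, b], continuous l}.
Proof.
apply: (@eq_within _ _ _ (fun t => V t + al * \int[leb]_(x in `[a, t]) l x)).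
  by move=> t /lE.
by apply: withinD => //; apply: withinZ; apply: within_integral => //; exact: iL.
Qed.

Let cD : {within `[a, b], continuous (D b)}.
Proof.
apply: (@eq_within _ _ _ (fun t => (v0 + expR (- al * (t - a)) * l t) +
          al * \int[leb]_(x in `[a, t]) D b x)).
  by move=> t tab; rewrite -DE.
apply: withinD.
  apply: withinD; first by apply: continuous_subspaceT => x; exact: cvg_cst.
  by apply: withinM => //; exact: within_expR.
by apply: withinZ; apply: within_integral => //; exact: iD.
Qed.

Lemma variance_continuous : {within `[a, b], continuous (fun t => C t t)}.
Proof.
apply: (@eq_within _ _ _ (fun t => expR (al * (t - a)) * D b t)).
  by move=> t /vE.
by apply: withinM => //; exact: within_expR.
Qed.

Let cy : {within `[a, b], continuous y}.
Proof.
apply: (@eq_within _ _ _ (fun t => C t t + m t * m t)).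
  by move=> t /yE ->; rewrite expr2.
by apply: withinD; [exact: variance_continuous|exact: withinM].
Qed.

(** Let v t = C t t. Continuity of v, hence of y, makes V, then l, then D b
    differentiable; their derivatives combine into (2 al) v + y, and y = v + m^2. *)
Lemma variance_derive t : a < t < b ->
  is_derive t 1 (fun t => C t t) ((2 * al + 1) * C t t + m t ^+ 2).
Proof.
move=> tab.
have tab' : a <= t <= b by case/andP: tab => /ltW -> /ltW ->.
have dV : is_derive t 1 V (y t) by exact: is_derive_integral tab cy.
have dl : is_derive t 1 l (y t + al * l t).
  apply: (@eq_is_derive _ a b (fun t => V t + al * \int[leb]_(x in `[a, t]) l x)) => //.
    by move=> x /lE.
  have dI := is_derive_integral tab cl.
  by apply: is_derive_eq; rewrite /GRing.scale/=; ring.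
have dE1 := is_derive_expR_affine (- al) a t.
have dE2 := is_derive_expR_affine al a t.
have dD : is_derive t 1 (D b) (expR (- al * (t - a)) * y t + al * D b t).
  apply: (@eq_is_derive _ a b (fun t => (v0 + expR (- al * (t - a)) * l t) +
          al * \int[leb]_(x in `[a, t]) D b x)); first exact: tab.
    by move=> x xab; rewrite -DE.
  have dI := is_derive_integral tab cD.
  by apply: is_derive_eq; rewrite /GRing.scale/=; ring.
apply: (@eq_is_derive _ a b (fun t => expR (al * (t - a)) * D b t)) => //.
  by move=> x /vE.
apply: is_derive_eq; rewrite /GRing.scale/=.
have e : expR (al * (t - a)) * expR (- al * (t - a)) = 1.
  by rewrite -expRD mulNr addrN expR0.
rewrite mulrDr mulrA e mul1r (yE tab') (vE tab'); ring.
Qed.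

Lemma variance_initial : C a a = v0.
Proof.
have aab : a <= a <= b by rewrite lexx.
have L0 : L a a = 0.
  by rewrite (LE aab aab) minxx /V !set_itv1 !Rintegral_set1 mulr0 addr0.
rewrite (CE aab aab) L0 subrr mulr0 expR0 mulr1 addr0.
by rewrite set_itv1 Rintegral_set1 mulr0 addr0.
Qed.

End covariance_system.

(** * Second moment of the solution *)

(** Fubini for the square of the process. *)
Lemma integrable_energy (R : realType) d (Omega : measurableType d)
    (P : probability Omega R) (a b : R) (H : R -> Omega -> R) :
  sqint (@lebesgue_measure R \x P)%E (on_itv a b H) ->
  (forall u, a <= u <= b -> sqint P (H u)) ->
  itv_integrable a b (fun u => ip P (H u) (H u)).
Proof.
move=> sH sHu.
have iF := integrable_fubini_F sH.2.
have mI : measurable (`[a, b]%classic : set (measurableTypeR R)).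
  exact: measurable_itv.
have := integrableS measurableT mI (@subsetT _ _) iF.
apply: eq_integrable => // u uab; rewrite /fubini_F/= /on_itv/=.
have uab' : a <= u <= b by move: uab; rewrite inE/= in_itv.
have sHH := sqint_mul (sHu u uab') (sHu u uab').
rewrite /ip /Rintegral fineK; last exact: integrable_fin_num.
by apply: eq_integral => w _; rewrite indicE uab mul1r expr2.
Qed.

Definition expR_integral (R : realType) (k x : R) : R :=
  if k == 0 then x else (expR (k * x) - 1) / k.

Lemma expR_integral0 (R : realType) (k : R) : expR_integral k 0 = 0.
Proof. by rewrite /expR_integral mulr0 expR0 subrr mul0r if_same. Qed.

Lemma is_derive_expR_integral (R : realType) (k s x : R) :
  is_derive x 1 (fun t : R => expR_integral k (t - s)) (expR (k * (x - s))).
Proof.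
rewrite /expR_integral; have [->|k0] := eqVneq k 0.
  by apply: is_derive_eq; rewrite mul0r expR0 oppr0 addr0.
have dE := is_derive_expR_affine k s x.
rewrite (_ : (fun _ => _) = (fun t : R => k^-1 * (expR (k * (t - s)) - 1))).
  by apply: is_derive_eq; rewrite /GRing.scale/=; field.
by apply/funext => t; rewrite mulrC.
Qed.

Section sde.
Context (R : realType) d (Omega : measurableType d) (P : probability Omega R).
Variable W : R -> {RV P >-> R}.
Hypothesis wW : two_sided_wiener W.
Hypothesis cP : measure_is_complete P.
Notation leb := (@lebesgue_measure R).
Notation lebP := (leb \x P)%E.
Variables (al be s T : R) (X : Omega -> R) (Z : R -> Omega -> R).
Hypothesis sT : s <= T.
Hypothesis solZ : mf_sde_solution W al be s X Z.
Implicit Types (G : Omega -> R) (t u q : R).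

Let one : Omega -> R := fun=> 1.
Let s1 : sqint P one. Proof. exact: sqint1. Qed.

Let sol_adapted t : s <= t -> measurable_wrt (wiener_filtration W t) (Z t).
Proof. by case: solZ => _ H /H[[]]. Qed.

Let sZ t : s <= t -> sqint P (Z t).
Proof. by case: solZ => _ H /H[[LZ _] _]; exact: sqint_Lfun. Qed.

(** The Ito integrals are given separately for each horizon t; they are chosen
    together as one process N. *)
Let martingale_part : exists N : R -> Omega -> R, forall t, s <= t ->
  is_ito_integral W s t Z (N t) /\
  {ae P, forall w, Z t w - Z s w - N t w =
    \int[leb]_(u in `[s, t]) (al * Z u w + be * fine 'E_P[Z u])}.
Proof.
suff /choice[N HN] : forall t, exists I : Omega -> R, s <= t ->
    is_ito_integral W s t Z I /\ {ae P, forall w, Z t w - Z s w - I w =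
      \int[leb]_(u in `[s, t]) (al * Z u w + be * fine 'E_P[Z u])} by exists N.
move=> t; have [st|ts] := leP s t; last by exists (fun=> 0).
case: solZ => _ /(_ t st)[_ [I iI aeZ]]; exists I => _; split => //.
by apply: filterS aeZ => w ->; ring.
Qed.

Let N := projT1 (cid martingale_part).
Let N_ito t : s <= t -> is_ito_integral W s t Z (N t).
Proof. by move=> st; have [] := projT2 (cid martingale_part) t st. Qed.
Let Z_drift t : s <= t -> {ae P, forall w, Z t w - Z s w - N t w =
    \int[leb]_(u in `[s, t]) (al * Z u w + be * fine 'E_P[Z u])}.
Proof. by move=> st; have [] := projT2 (cid martingale_part) t st. Qed.

Let sN t : s <= t -> sqint P (N t).
Proof. by move=> /N_ito[_ LN _]; exact: sqint_Lfun. Qed.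

Let sHZ t : s <= t -> sqint lebP (on_itv s t Z).
Proof. by move=> /N_ito[[mZ _ fZ] _ _]; exact: sqint_on_itv. Qed.

Let sZu t u : s <= u <= t -> sqint P (Z u).
Proof. by move=> /andP[su _]; exact: sZ. Qed.

Let ip_N_adapted t G : s <= t -> measurable_wrt (wiener_filtration W s) G ->
  sqint P G -> ip P G (N t) = 0.
Proof. by move=> st; exact: (ip_ito_integral_adapted wW cP (N_ito st)). Qed.

Let m t := ip P one (Z t).

Let expectation_m u : s <= u -> fine 'E_P[Z u] = m u.
Proof.
by move=> su; rewrite unlock /m /ip /Rintegral; under [in RHS]eq_integral do rewrite mul1r.
Qed.

Let int_ip t G : s <= t -> sqint P G -> itv_integrable s t (fun u => ip P G (Z u)).
Proof. by move=> st sG; apply: (integrable_ip (sHZ st) sG) => u; exact: sZu. Qed.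

Let ip_evolution t G : s <= t -> sqint P G ->
  ip P G (Z t) = ip P G (Z s) + al * \int[leb]_(u in `[s, t]) ip P G (Z u) +
    be * (\int[leb]_(u in `[s, t]) m u) * ip P one G + ip P G (N t).
Proof.
move=> st sG.
have im := int_ip st s1.
have ic : leb.-integrable `[s, t] (fun u => (be * fine 'E_P[Z u])%:E).
  apply: eq_itv_integrable (itv_integrableZ be im) => u /andP[su _].
  by rewrite expectation_m.
have sZs := sZ (lexx s).
have sD := sqintB (sqintB (sZ st) sZs) (sN st).
have := ip_drift (sHZ st) sG sD (@sZu t) ic (Z_drift st).
rewrite (ipBr (sqintB (sZ st) sZs) (sN st) sG) (ipBr (sZ st) sZs sG).
rewrite (@eq_itv_integral _ s t (fun u => be * fine 'E_P[Z u]) (fun u => be * m u)); last first.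
  by move=> u /andP[su _]; rewrite expectation_m.
rewrite RintegralZl//.
have -> : \int[P]_w G w = ip P one G.
  by apply: eq_Rintegral => w _; rewrite mul1r.
by move=> h; lra.
Qed.

Let mean_N t : s <= t -> ip P one (N t) = 0.
Proof. by move=> st; apply: ip_N_adapted => //; exact: adapted_cst. Qed.

Let m_evolution t : s <= t -> m t = m s + (al + be) * \int[leb]_(u in `[s, t]) m u.
Proof.
by move=> st; rewrite [LHS](ip_evolution st s1) (mean_N st) (ip11 P) /m; ring.
Qed.

Let m_exp t : s <= t <= T -> m t = m s * expR ((al + be) * (t - s)).
Proof.
apply: volterra_exp; first exact: int_ip.
by move=> u /andP[su _]; exact: m_evolution.
Qed.

(** The covariance of G and Z t. Centring makes the mean-field term disappear
    from its evolution, see [phi_evolution]. *)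
Let phi G t := ip P G (Z t) - m t * ip P one G.

Let int_phi G t : s <= t -> sqint P G -> itv_integrable s t (phi G).
Proof.
move=> st sG; apply: itv_integrableB; first exact: int_ip.
have := itv_integrableZ (ip P one G) (int_ip st s1).
by apply: eq_itv_integrable => u _; rewrite mulrC.
Qed.

Let phi_evolution t G : s <= t -> sqint P G ->
  phi G t = phi G s + ip P G (N t) + al * \int[leb]_(u in `[s, t]) phi G u.
Proof.
move=> st sG; rewrite /phi RintegralB//; last 2 first.
- exact: int_ip.
- have := itv_integrableZ (ip P one G) (int_ip st s1).
  by apply: eq_itv_integrable => u _; rewrite mulrC.
rewrite RintegralZr//; last exact: (int_ip st s1).
by rewrite (ip_evolution st sG) (m_evolution st); ring.
Qed.

Let y t := ip P (Z t) (Z t).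
Let v0 := y s - m s ^+ 2.
Let L q t := phi (N q) t.
Let C q t := phi (Z q) t.

Let int_y t : s <= t -> itv_integrable s t y.
Proof. by move=> st; apply: integrable_energy; [exact: sHZ|exact: sZu]. Qed.

(** This is the only place where the quadratic variation of the noise enters. *)
Let N_covariance q t : s <= q -> s <= t ->
  ip P (N q) (N t) = \int[leb]_(u in `[s, Num.min q t]) y u.
Proof.
have ordered q' t' : s <= q' -> q' <= t' ->
    ip P (N q') (N t') = \int[leb]_(u in `[s, q']) y u.
  move=> sq qt; have st := le_trans sq qt.
  rewrite (ito_covariance wW cP qt (N_ito sq) (N_ito st)) /Rintegral.
  congr fine; apply: eq_integral => u; rewrite inE/= in_itv/= => suq.
  have sZZ := sqint_mul (sZu suq) (sZu suq).
  rewrite unlock /y /ip /Rintegral fineK; last exact: integrable_fin_num.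
  by apply: eq_integral => w _; rewrite expr2.
move=> sq st; have [qt|tq] := leP q t; first exact: ordered.
by rewrite ipC ordered// ltW.
Qed.

Let phi_Zs t : s <= t <= T -> phi (Z s) t = v0 * expR (al * (t - s)).
Proof.
have sZs := sZ (lexx s).
apply: volterra_exp; first exact: int_phi.
move=> u /andP[su _]; rewrite (phi_evolution su sZs).
by rewrite (ip_N_adapted su (sol_adapted (lexx s)) sZs) addr0; congr (_ + _).
Qed.

Let LE q t : s <= q <= T -> s <= t <= T ->
  L q t = \int[leb]_(u in `[s, Num.min q t]) y u +
    al * \int[leb]_(u in `[s, t]) L q u.
Proof.
move=> /andP[sq _] /andP[st _]; rewrite /L (phi_evolution st (sN sq)).
rewrite (N_covariance sq st); congr (_ + _).
rewrite /phi (mean_N sq) mulr0 subr0 ipC.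
by rewrite (ip_N_adapted sq (sol_adapted (lexx s)) (sZ (lexx s))) add0r.
Qed.

Let CE q t : s <= q <= T -> s <= t <= T ->
  C q t = (v0 * expR (al * (q - s)) + L t q) +
    al * \int[leb]_(u in `[s, t]) C q u.
Proof.
move=> sqT /andP[st _]; have sq : s <= q by case/andP: sqT.
rewrite /C (phi_evolution st (sZ sq)) -(phi_Zs sqT); congr (_ + _ + _).
  by rewrite /phi ipC -!/(m _) mulrC.
by rewrite /L /phi (mean_N st) mulr0 subr0 ipC.
Qed.

(** The diagonal of C solves v' = (2 al + 1) v + m^2 with m explicit; the
    solution G is found by variation of constants. *)
Lemma sde_second_moment :
  ip P (Z T) (Z T) = expR ((2 * al + 1) * (T - s)) *
    (ip P (Z s) (Z s) - ip P one (Z s) ^+ 2 + ip P one (Z s) ^+ 2 *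
      (expR_integral (2 * be - 1) (T - s) + expR ((2 * be - 1) * (T - s)))).
Proof.
have cm : {within `[s, T], continuous m}.
  apply: (@eq_within _ _ _ (fun t => m s * expR ((al + be) * (t - s)))).
    by move=> t /m_exp.
  by apply: withinZ; exact: within_expR.
have iL q : s <= q <= T -> itv_integrable s T (L q).
  by move=> /andP[sq _]; apply: int_phi => //; exact: sN.
have iC q : s <= q <= T -> itv_integrable s T (C q).
  by move=> /andP[sq _]; apply: int_phi => //; exact: sZ.
have yE t : s <= t <= T -> y t = C t t + m t ^+ 2.
  by move=> _; rewrite /C /phi -/(m t) -/(y t) expr2 subrK.
have cv := variance_continuous sT (int_y sT) iL iC LE CE.
have dv := @variance_derive _ s T al v0 y m L C sT (int_y sT) cm iL iC LE CE yE.
have vs := variance_initial sT LE CE.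
pose G t := expR ((2 * al + 1) * (t - s)) *
  (v0 + m s ^+ 2 * expR_integral (2 * be - 1) (t - s)).
have dG t : is_derive t 1 G ((2 * al + 1) * G t +
    m s ^+ 2 * expR (2 * (al + be) * (t - s))).
  have d1 := is_derive_expR_affine (2 * al + 1) s t.
  have d2 := is_derive_expR_integral (2 * be - 1) s t.
  apply: is_derive_eq; rewrite /GRing.scale/=.
  have -> : expR (2 * (al + be) * (t - s)) =
    expR ((2 * al + 1) * (t - s)) * expR ((2 * be - 1) * (t - s)).
    by rewrite -expRD; congr expR; ring.
  by rewrite /G; ring.
have cG : {within `[s, T], continuous G}.
  apply: continuous_subspaceT => t; apply: differentiable_continuous.
  by apply/derivable1_diffP; case: (dG t).
have vT : C T T = G T.
  apply: (@ode_unique _ s T (2 * al + 1) (fun t => C t t) G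
    (fun t => m s ^+ 2 * expR (2 * (al + be) * (t - s)))) => //.
  - move=> t tsT; apply: is_derive_eq (dv t tsT) _; congr (_ + _).
    have tsT' : s <= t <= T by case/andP: tsT => /ltW -> /ltW ->.
    rewrite (m_exp tsT') exprMn; congr (_ * _).
    by rewrite expr2 -expRD; congr expR; ring.
  - by rewrite vs /G subrr expR_integral0 !mulr0 expR0 mul1r addr0.
  - by rewrite sT lexx.
have TsT : s <= T <= T by rewrite sT lexx.
rewrite -/(y T) (yE T TsT) vT (m_exp TsT) /G /v0 -/(y s) -!/(m s).
have -> : (m s * expR ((al + be) * (T - s))) ^+ 2 = m s ^+ 2 *
    (expR ((2 * al + 1) * (T - s)) * expR ((2 * be - 1) * (T - s))).
  by rewrite -expRD exprMn; congr (_ * _); rewrite expr2 -expRD; congr expR; ring.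
ring.
Qed.

End sde.

(** * The dichotomy spectrum *)

Section growth.
Context (R : realType).
Implicit Types (k tau nsq msq A B p q : R).

Lemma expR_integralK k tau : k * expR_integral k tau = expR (k * tau) - 1.
Proof.
rewrite /expR_integral; have [->|k0] := eqVneq k 0; last by field.
by rewrite !mul0r expR0 subrr.
Qed.

Lemma expR_integral_ge0 k tau : 0 <= tau -> 0 <= expR_integral k tau.
Proof.
move=> t0; rewrite /expR_integral; case: eqVneq => // k0.
have [kp|kn] := ltP 0 k.
  by rewrite divr_ge0 ?(ltW kp)// subr_ge0 -[leLHS]expR0 ler_expR mulr_ge0// ltW.
rewrite mulr_le0// ?invr_le0// subr_le0 expR_le1.
by rewrite mulr_le0_ge0.
Qed.

(** The factor of e^{(2 alpha + 1) tau} in the second moment at time tau, when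
    the initial second moment is nsq and the initial squared mean msq. *)
Definition growth k nsq msq tau :=
  nsq - msq + msq * (expR_integral k tau + expR (k * tau)).

(** With E the integral of e^{k r}, the relation k E = e^{k tau} - 1 bounds
    (1 + |k|) (E + e^{k tau}) below by 1 for both signs of k. *)
Lemma growth_ge k nsq msq tau : 0 <= tau -> 0 <= msq <= nsq ->
  (1 + `|k|)^-1 * nsq <= growth k nsq msq tau.
Proof.
move=> t0 /andP[m0 mn]; rewrite /growth.
have E0 := expR_integral_ge0 k t0; have Ek := expR_integralK k tau.
set E := expR_integral k tau in E0 Ek *; set e := expR (k * tau) in Ek *.
have e0 : 0 < e by exact: expR_gt0.
have c0 : 0 < 1 + `|k| by rewrite ltr_pwDl.
rewrite mulrC ler_pdivrMr//.
have h : 1 <= (1 + `|k|) * (E + e).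
  have [kp|kn] := leP 0 k.
    by rewrite ger0_norm//; have := mulr_ge0 kp E0; have := mulr_ge0 kp (ltW e0); lra.
  have nk : 0 <= - k by rewrite oppr_ge0 ltW.
  by rewrite ler0_norm ?(ltW kn)//; have := mulr_ge0 nk (ltW e0); lra.
have : 0 <= msq * ((1 + `|k|) * (E + e) - 1) by rewrite mulr_ge0// subr_ge0.
have : 0 <= (nsq - msq) * `|k| by rewrite mulr_ge0// subr_ge0.
by move: (`|k|) => K; lra.
Qed.

Lemma growth_ge_mean k nsq msq tau : 0 <= tau -> 0 <= msq <= nsq ->
  msq * expR (k * tau) <= growth k nsq msq tau.
Proof.
move=> t0 /andP[m0 mn]; rewrite /growth mulrDr.
have := mulr_ge0 m0 (expR_integral_ge0 k t0); lra.
Qed.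

Lemma growth_le_linear k nsq msq tau : k <= 0 -> 0 <= tau -> 0 <= msq <= nsq ->
  growth k nsq msq tau <= nsq * (1 + tau).
Proof.
move=> k0 t0 /andP[m0 mn]; rewrite /growth.
have e1 : expR (k * tau) <= 1 by rewrite expR_le1 mulr_le0_ge0.
have E1 : expR_integral k tau <= tau.
  rewrite /expR_integral; case: eqVneq => // kn0.
  have kn : k < 0 by rewrite lt_neqAle kn0.
  rewrite ler_ndivrMr// lerBrDr addrC mulrC.
  exact: expR_ge1Dx.
have : msq * (expR_integral k tau + expR (k * tau)) <= msq * (tau + 1).
  by rewrite ler_wpM2l// lerD.
have : msq * tau <= nsq * tau by rewrite ler_wpM2r.
lra.
Qed.

Lemma growth_le_exp k nsq msq tau : 0 < k -> 0 <= tau -> 0 <= msq <= nsq ->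
  growth k nsq msq tau <= (2 + k^-1) * expR (k * tau) * nsq.
Proof.
move=> k0 t0 /andP[m0 mn]; rewrite /growth.
have e1 : 1 <= expR (k * tau) by rewrite -[leLHS]expR0 ler_expR mulr_ge0// ltW.
have ki : 0 < k^-1 by rewrite invr_gt0.
have -> : expR_integral k tau = (expR (k * tau) - 1) * k^-1.
  by rewrite /expR_integral gt_eqF.
set e := expR (k * tau) in e1 *; set i := k^-1 in ki *.
have n0 := le_trans m0 mn.
have h1 : msq * ((e - 1) * i + e) <= nsq * ((e - 1) * i + e).
  by rewrite ler_wpM2r// addr_ge0// ?mulr_ge0 ?(ltW ki) ?subr_ge0//; lra.
have h2 : nsq * 1 <= nsq * e by rewrite ler_wpM2l.
have h3 : 0 <= nsq * i by rewrite mulr_ge0// ltW.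
nra.
Qed.

(** This excludes a dichotomy at a growth rate that is attained exactly. *)
Lemma expR_dominates p q A B : q < p ->
  (forall tau, 0 <= tau -> A * expR (p * tau) <= B * expR (q * tau)) -> A <= 0.
Proof.
move=> qp H; rewrite leNgt; apply/negP => A0.
have AB tau : 0 <= tau -> A * (1 + (p - q) * tau) <= B.
  move=> t0; apply: le_trans (_ : A * expR ((p - q) * tau) <= _).
    by rewrite ler_pM2l// expR_ge1Dx.
  rewrite mulrBl expRB mulrA ler_pdivrMr ?expR_gt0//; exact: H.
have B0 : 0 < B by apply: lt_le_trans A0 _; have := AB 0; rewrite mulr0 addr0 mulr1; apply.
have pq : 0 < p - q by rewrite subr_gt0.
have := AB (B / (A * (p - q))) (divr_ge0 (ltW B0) (ltW (mulr_gt0 A0 pq))).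
have -> : A * (1 + (p - q) * (B / (A * (p - q)))) = A + B.
  by field; rewrite !gt_eqF.
lra.
Qed.

End growth.

Section dichotomy.
Context (R : realType) d (Omega : measurableType d) (P : probability Omega R).
Variable W : R -> {RV P >-> R}.
Variables (al be : R) (Phi : R -> R -> (Omega -> R) -> (Omega -> R)).
Hypothesis cP : measure_is_complete P.
Hypothesis wW : two_sided_wiener W.
Hypothesis genPhi : generated_by_mf_sde W al be Phi.
Implicit Types (X Y : Omega -> R) (s t g : R).

Let one : Omega -> R := fun=> 1.
Let s1 : sqint P one. Proof. exact: sqint1. Qed.

Definition mean X := ip P one X.

Lemma mean_cst c : mean (fun=> c) = c.
Proof.
rewrite /mean (_ : (fun=> c) = (fun w => c * one w)); last first.
  by apply/funext => w; rewrite mulr1.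
by rewrite ipZr// (ip11 P) mulr1.
Qed.

Lemma mean_sqr_le X : sqint P X -> 0 <= mean X ^+ 2 <= ip P X X.
Proof.
by move=> sX; rewrite sqr_ge0/= -[leRHS]mul1r -(ip11 P); exact: ip_cauchy_schwarz.
Qed.

Lemma ms_norm_sqr X : ms_norm P X ^+ 2 = ip P X X.
Proof.
rewrite /ms_norm sqr_sqrtr.
  rewrite unlock ip_expectation; congr fine; apply: eq_integral => w _.
  by rewrite real_normK ?num_real.
rewrite fine_ge0// expectation_ge0// => w; exact: sqr_ge0.
Qed.

Lemma ms_norm_ge0 X : 0 <= ms_norm P X. Proof. exact: sqrtr_ge0. Qed.

Lemma eq_ip_self_ae X Y : sqint P X -> sqint P Y -> X = Y %[ae P] ->
  ip P X X = ip P Y Y.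
Proof.
move=> [mX _] [mY _] XY.
by rewrite (eq_ip_ae mX mY mX XY) ipC (eq_ip_ae mX mY mY XY).
Qed.

Lemma eq_mean_ae X Y : sqint P X -> sqint P Y -> X = Y %[ae P] -> mean X = mean Y.
Proof.
by move=> [mX _] [mY _] XY; rewrite /mean ipC (eq_ip_ae mX mY s1.1 XY) ipC.
Qed.

Lemma ip_self_eq0 X : sqint P X -> ip P X X = 0 -> X = (fun=> 0) %[ae P].
Proof.
move=> [mX iX] X0.
have : (\int[P]_w `|(X w ^+ 2)%:E| = 0)%E.
  under eq_integral do rewrite abse_EFin ger0_norm ?sqr_ge0//.
  rewrite -[LHS]fineK; last exact: integrable_fin_num.
  by rewrite -ip_expectation X0.
have mX2 : measurable_fun setT (fun w => (X w ^+ 2)%:E) by exact: measurable_int iX.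
move/(ae_eq_integral_abs P measurableT mX2); apply: filterS => w + _ => /(_ I) /eqP.
by rewrite eqe sqrf_eq0 => /eqP.
Qed.

Lemma ms_space_sqint t X : ms_space W t X -> sqint P X.
Proof. by case=> LX _; exact: sqint_Lfun. Qed.

Lemma ms_space_lin t (a : R) X Y : ms_space W t X -> ms_space W t Y ->
  ms_space W t (fun w => a * X w + Y w).
Proof.
move=> [LX aX] [LY aY]; split.
  exact: (Lfun_submod_closed P (lee1n 2)).2.
by apply: adaptedD => //; apply: adaptedM => //; exact: adapted_cst.
Qed.

Lemma ms_space_cst t c : ms_space W t (fun=> c).
Proof. by split; [exact: Lfun_cst|exact: adapted_cst]. Qed.

(** The solution chosen by [genPhi] for X starts almost surely at X and ends
    almost surely at Phi t s X. *)
Lemma Phi_norm s t X : s <= t -> ms_space W s X ->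
  ms_norm P (Phi t s X) ^+ 2 = expR (2 * (al + 1 / 2) * (t - s)) *
    growth (2 * be - 1) (ms_norm P X ^+ 2) (mean X ^+ 2) (t - s).
Proof.
move=> st hX; have [Z solZ /(_ t st)[hPhi PhiZ]] := genPhi hX.
have [ZsX solt] := solZ.
have sZt : sqint P (Z t) by have [/ms_space_sqint] := solt t st.
have sZs : sqint P (Z s) by have [/ms_space_sqint] := solt s (lexx s).
have sX := ms_space_sqint hX.
rewrite !ms_norm_sqr (eq_ip_self_ae (ms_space_sqint hPhi) sZt PhiZ).
rewrite (sde_second_moment wW cP st solZ) /growth.
rewrite (eq_ip_self_ae sZs sX ZsX) -/(mean _) (eq_mean_ae sZs sX ZsX).
by have -> : 2 * al + 1 = 2 * (al + 1 / 2) by field.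
Qed.

Lemma ms_subspace_all t : ms_subspace W t (ms_space W t).
Proof.
split => //; first exact: ms_space_cst.
by move=> a X Y; exact: ms_space_lin.
Qed.

Definition null_space t : set (Omega -> R) :=
  [set X | ms_space W t X /\ X = (fun=> 0) %[ae P]].

Lemma ms_subspace_null t : ms_subspace W t (null_space t).
Proof.
split => [X []//||a X Y [hX X0] [hY Y0]|X Y [hX X0] hY XY].
- by split; [exact: ms_space_cst|exact: filterE].
- split; first exact: ms_space_lin.
  by apply: filterS2 X0 Y0 => w X0 Y0 _; rewrite X0// Y0// mulr0 addr0.
- by split=> //; apply: filterS2 X0 XY => w X0 XY _; rewrite -XY// X0.
Qed.

Lemma ms_direct_sum_all_null t : ms_direct_sum W t (ms_space W t) (null_space t).
Proof.
split; [exact: ms_subspace_all|exact: ms_subspace_null| |by move=> X _ []].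
move=> X hX; exists X, (fun=> 0); split => //.
  by split; [exact: ms_space_cst|exact: filterE].
by apply: filterE => w _; rewrite addr0.
Qed.

Lemma ms_direct_sum_null_all t : ms_direct_sum W t (null_space t) (ms_space W t).
Proof.
split; [exact: ms_subspace_null|exact: ms_subspace_all| |by move=> X []].
move=> X hX; exists (fun=> 0), X; split => //.
  by split; [exact: ms_space_cst|exact: filterE].
by apply: filterE => w _; rewrite add0r.
Qed.

Lemma ms_norm_null t X : null_space t X -> ms_norm P X = 0.
Proof.
move=> [/ms_space_sqint sX X0]; apply/eqP; rewrite -sqrf_eq0 ms_norm_sqr.
by rewrite (eq_ip_self_ae sX (sqint0 P) X0) ip0l.
Qed.

Let expR_sqr (x y : R) : expR (x * y) ^+ 2 = expR (2 * x * y).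
Proof. by rewrite expr2 -expRD; congr expR; ring. Qed.

Lemma dichotomy_of_decay g (C la : R) : 0 < C -> la < g ->
  (forall s t X, s <= t -> ms_space W s X ->
    ms_norm P (Phi t s X) ^+ 2 <= C * expR (2 * la * (t - s)) * ms_norm P X ^+ 2) ->
  exponential_dichotomy W Phi g.
Proof.
move=> C0 lag H; exists (Num.sqrt C), (g - la), null_space, (ms_space W).
split => [|||s t X st hX|s t X st nX].
- by rewrite sqrtr_gt0.
- by rewrite subr_gt0.
- exact: ms_direct_sum_null_all.
- set b := (X in _ <= X).
  have b0 : 0 <= b by rewrite !mulr_ge0 ?ms_norm_ge0 ?expR_ge0// sqrtr_ge0.
  rewrite -ler_sqr ?nnegrE ?ms_norm_ge0//.
  apply: le_trans (H s t X st hX) _; rewrite /b !exprMn expR_sqr.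
  by rewrite subKr (sqr_sqrtr (ltW C0)).
- by rewrite (ms_norm_null nX) mulr0 ms_norm_ge0.
Qed.

Lemma dichotomy_of_growth g (c la : R) : 0 < c -> g < la ->
  (forall s t X, s <= t -> ms_space W s X ->
    c * expR (2 * la * (t - s)) * ms_norm P X ^+ 2 <= ms_norm P (Phi t s X) ^+ 2) ->
  exponential_dichotomy W Phi g.
Proof.
move=> c0 gla H; exists (Num.sqrt c)^-1, (la - g), (ms_space W), null_space.
have sc0 : 0 < Num.sqrt c by rewrite sqrtr_gt0.
split => [|||s t X st nX|s t X st hX].
- by rewrite invr_gt0.
- by rewrite subr_gt0.
- exact: ms_direct_sum_all_null.
- have hX : ms_space W s X by case: nX.
  suff -> : ms_norm P (Phi t s X) = 0.
    by rewrite !mulr_ge0 ?ms_norm_ge0 ?expR_ge0// invr_ge0 ltW.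
  apply/eqP; rewrite -sqrf_eq0 (Phi_norm st hX) (ms_norm_null nX).
  have := mean_sqr_le (ms_space_sqint hX).
  rewrite -ms_norm_sqr (ms_norm_null nX) expr0n/= => m0.
  have -> : mean X ^+ 2 = 0 by apply/eqP; rewrite eq_le andbC.
  by rewrite /growth subrr mul0r addr0 mulr0.
- rewrite invrK; set b := (X in X <= _).
  have b0 : 0 <= b by rewrite !mulr_ge0 ?ms_norm_ge0 ?expR_ge0// ltW.
  rewrite -ler_sqr ?nnegrE ?ms_norm_ge0//.
  apply: le_trans (H s t X st hX); rewrite /b !exprMn expR_sqr sqr_sqrtr ?(ltW c0)//.
  by rewrite subrKC.
Qed.

Definition constant_space t : set (Omega -> R) :=
  [set X | ms_space W t X /\ exists c : R, X = (fun=> c) %[ae P]].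

Definition centered_space t : set (Omega -> R) :=
  [set X | ms_space W t X /\ mean X = 0].

Lemma mean_lin t (a : R) X Y : ms_space W t X -> ms_space W t Y ->
  mean (fun w => a * X w + Y w) = a * mean X + mean Y.
Proof.
move=> /ms_space_sqint sX /ms_space_sqint sY.
by rewrite /mean ipDr// ?ipZr//; exact: sqintZ.
Qed.

(** The orthogonal splitting X = E X + (X - E X). *)
Lemma ms_direct_sum_constant_centered t :
  ms_direct_sum W t (constant_space t) (centered_space t).
Proof.
split.
- split => [X []//||a X Y [hX [b Xb]] [hY [c Yc]]|X Y [hX [c Xc]] hY XY].
  + by split; [exact: ms_space_cst|exists 0; exact: filterE].
  + split; first exact: ms_space_lin.
    exists (a * b + c).
    by apply: filterS2 Xb Yc => w Xb Yc _; rewrite Xb// Yc.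
  + by split=> //; exists c; apply: filterS2 Xc XY => w Xc XY _; rewrite -XY// Xc.
- split => [X []//||a X Y [hX X0] [hY Y0]|X Y [hX X0] hY XY].
  + by split; [exact: ms_space_cst|exact: mean_cst].
  + split; first exact: ms_space_lin.
    by rewrite (mean_lin _ hX hY) X0 Y0 mulr0 addr0.
  + split=> //; rewrite -X0; apply/esym.
    exact: eq_mean_ae (ms_space_sqint hX) (ms_space_sqint hY) XY.
- move=> X hX; exists (fun=> mean X), (fun w => (-1) * mean X + X w); split.
  + by split; [exact: ms_space_cst|exists (mean X); exact: filterE].
  + have hc := ms_space_cst t (mean X).
    split; first exact: (ms_space_lin (-1) hc hX).
    by rewrite (mean_lin (-1) hc hX) mean_cst mulN1r addNr.
  + by apply: filterE => w _; rewrite mulN1r addNKr.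
- move=> X [hX [c Xc]] [_ X0].
  have c0 : c = 0.
    rewrite -X0 (eq_mean_ae (ms_space_sqint hX) _ Xc) ?mean_cst//.
    exact: sqint_cst (probability_lty P).
  by rewrite c0 in Xc.
Qed.

(** Centred variables grow exactly at the lower rate. For a constant the squared
    mean is the whole second moment, and [growth_ge_mean] gives the upper rate. *)
Lemma dichotomy_between g : al + 1 / 2 < g -> g < al + be ->
  exponential_dichotomy W Phi g.
Proof.
move=> l1g gl2; pose kap := Num.min (g - (al + 1 / 2)) (al + be - g).
exists 1, kap, constant_space, centered_space.
split => [|||s t X st [hX X0]|s t X st [hX [c Xc]]].
- by [].
- by rewrite lt_min !subr_gt0 l1g gl2.
- exact: ms_direct_sum_constant_centered.
- have ts : 0 <= t - s by rewrite subr_ge0.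
  rewrite mul1r -ler_sqr ?nnegrE ?mulr_ge0 ?ms_norm_ge0 ?expR_ge0//.
  rewrite (Phi_norm st hX) X0 expr0n/= /growth mul0r subr0 addr0.
  rewrite exprMn expR_sqr ler_wpM2r ?sqr_ge0// ler_expR ler_wpM2r// ler_wpM2l//.
  by rewrite lerBrDl -lerBrDr ge_min lexx.
- have ts : 0 <= t - s by rewrite subr_ge0.
  have sX := ms_space_sqint hX.
  rewrite invr1 mul1r -ler_sqr ?nnegrE ?mulr_ge0 ?ms_norm_ge0 ?expR_ge0//.
  have mX : mean X ^+ 2 = ms_norm P X ^+ 2.
    have sc := sqint_cst c (probability_lty P).
    rewrite ms_norm_sqr (eq_ip_self_ae sX sc Xc) (eq_mean_ae sX sc Xc) mean_cst.
    rewrite -[X in ip P X _](_ : (fun w => c * one w) = _); last first.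
      by apply/funext => w; rewrite mulr1.
    by rewrite ipZl// -/(mean _) mean_cst expr2.
  rewrite (Phi_norm st hX) mX.
  have nn : 0 <= ms_norm P X ^+ 2 <= ms_norm P X ^+ 2 by rewrite sqr_ge0 lexx.
  apply: le_trans (ler_wpM2l (expR_ge0 _) (growth_ge_mean (2 * be - 1) ts nn)).
  rewrite mulrCA -expRD exprMn expR_sqr mulrC ler_wpM2l ?sqr_ge0// ler_expR.
  rewrite -mulrDl ler_wpM2r//.
  have : kap <= al + be - g by rewrite ge_min lexx orbT.
  lra.
Qed.

Lemma ms_norm_eq0 t X : ms_space W t X -> ms_norm P X ^+ 2 <= 0 ->
  X = (fun=> 0) %[ae P].
Proof.
move=> /ms_space_sqint sX n0; apply: ip_self_eq0 => //.
by apply/eqP; rewrite eq_le ip_ge0 andbT -ms_norm_sqr.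
Qed.

(** If the stable space is trivial, closure under almost sure equality makes the
    unstable space everything. *)
Lemma direct_sum_null_stable t U S X : ms_direct_sum W t U S ->
  (forall Y, S Y -> Y = (fun=> 0) %[ae P]) -> ms_space W t X -> U X.
Proof.
move=> [[_ _ _ Uae] _ dec _] S0 hX; have [Y [Y' [UY SY' XY]]] := dec X hX.
apply: (Uae Y) => //; apply: filterS2 XY (S0 _ SY') => w -> // Y0 _.
by rewrite Y0// addr0.
Qed.

Lemma direct_sum_null_unstable t U S X : ms_direct_sum W t U S ->
  (forall Y, U Y -> Y = (fun=> 0) %[ae P]) -> ms_space W t X -> S X.
Proof.
move=> [_ [_ _ _ Sae] dec _] U0 hX; have [Y [Y' [UY SY' XY]]] := dec X hX.
apply: (Sae Y') => //; apply: filterS2 XY (U0 _ UY) => w -> // Y0 _.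
by rewrite Y0// add0r.
Qed.

Lemma Phi_norm_ge s t X : s <= t -> ms_space W s X ->
  (1 + `|2 * be - 1|)^-1 * expR (2 * (al + 1 / 2) * (t - s)) * ms_norm P X ^+ 2 <=
  ms_norm P (Phi t s X) ^+ 2.
Proof.
move=> st hX; have ts : 0 <= t - s by rewrite subr_ge0.
rewrite (Phi_norm st hX) -mulrA mulrCA ler_wpM2l ?expR_ge0//.
by apply: growth_ge => //; rewrite ms_norm_sqr; exact: mean_sqr_le (ms_space_sqint hX).
Qed.

Lemma Phi_norm_le s t X : 1 / 2 < be -> s <= t -> ms_space W s X ->
  ms_norm P (Phi t s X) ^+ 2 <=
  (2 + (2 * be - 1)^-1) * expR (2 * (al + be) * (t - s)) * ms_norm P X ^+ 2.
Proof.
move=> be2 st hX; have ts : 0 <= t - s by rewrite subr_ge0.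
have k0 : 0 < 2 * be - 1 by lra.
have mn := mean_sqr_le (ms_space_sqint hX); rewrite -ms_norm_sqr in mn.
rewrite (Phi_norm st hX).
apply: le_trans (ler_wpM2l (expR_ge0 _) (growth_le_exp k0 ts mn)) _.
rewrite le_eqVlt; apply/orP; left; apply/eqP.
have -> : expR (2 * (al + be) * (t - s)) =
  expR (2 * (al + 1 / 2) * (t - s)) * expR ((2 * be - 1) * (t - s)).
  by rewrite -expRD; congr expR; field.
ring.
Qed.

Let sqr_upper (K g tau n N : R) : 0 <= N -> N <= K * expR (g * tau) * n ->
  N ^+ 2 <= K ^+ 2 * n ^+ 2 * expR (2 * g * tau).
Proof.
move=> N0 Nn; rewrite -expR_sqr -!exprMn mulrAC.
by rewrite lerXn2r ?nnegrE// (le_trans N0).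
Qed.

Let sqr_lower (K g tau n N : R) : 0 <= K -> 0 <= n ->
  K * expR (g * tau) * n <= N ->
  K ^+ 2 * n ^+ 2 * expR (2 * g * tau) <= N ^+ 2.
Proof.
move=> K0 n0 nN; rewrite -expR_sqr -!exprMn mulrAC.
have h : 0 <= K * expR (g * tau) * n by rewrite !mulr_ge0 ?expR_ge0.
by rewrite lerXn2r ?nnegrE// (le_trans h).
Qed.

(** By [Phi_norm_ge] a stable variable is null, so the centred increment
    W_0 - W_{-1} is unstable, but it grows exactly at the rate alpha + 1/2. *)
Lemma no_dichotomy_low : ~ exponential_dichotomy W Phi (al + 1 / 2).
Proof.
move=> [K [kap [U [S [K0 kap0 dec HS HU]]]]].
pose c := (1 + `|2 * be - 1|)^-1.
have c0 : 0 < c by rewrite invr_gt0 ltr_pwDl.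
have S0 Y : S 0 Y -> Y = (fun=> 0) %[ae P].
  move=> SY; have hY : ms_space W 0 Y by have [_ [sub _ _ _] _ _] := dec 0; exact: sub.
  apply: (ms_norm_eq0 hY).
  suff : c * ms_norm P Y ^+ 2 <= 0 by rewrite pmulr_rle0.
  apply: (@expR_dominates _ (2 * (al + 1 / 2)) (2 * (al + 1 / 2 - kap)) _
    (K ^+ 2 * ms_norm P Y ^+ 2)).
    by rewrite ltr_pM2l// gtrBl.
  move=> tau t0; have h1 := HS 0 tau Y t0 SY; have := Phi_norm_ge t0 hY.
  rewrite subr0 in h1 *; rewrite mulrAC => h2; apply: le_trans h2 _.
  exact: sqr_upper (ms_norm_ge0 _) h1.
have ab : -1 <= 0 :> R by rewrite lerN10.
have [sD D1 D2] := increment_moments wW ab.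
set X := increment W (-1) 0 in sD D1 D2.
have hX : ms_space W 0 X.
  by split; [exact: sqint_in_Lfun|exact: adapted_increment].
have X1 : ms_norm P X ^+ 2 = 1 by rewrite ms_norm_sqr D2 sub0r opprK.
have mX : mean X = 0 by rewrite /mean ipC.
have UX : U 0 X by exact: direct_sum_null_stable (dec 0) S0 hX.
suff : K^-1 ^+ 2 <= 0 by rewrite leNgt exprn_gt0// invr_gt0.
apply: (@expR_dominates _ (2 * (al + 1 / 2 + kap)) (2 * (al + 1 / 2)) _ 1).
  by rewrite ltr_pM2l// ltrDl.
move=> tau t0; have := HU 0 tau X t0 UX.
have K1 : 0 <= K^-1 by rewrite invr_ge0 ltW.
move=> /(sqr_lower K1 (ms_norm_ge0 X)).
rewrite (Phi_norm t0 hX) X1 mX expr0n/= /growth mul0r !subr0 addr0 !mulr1 !mul1r.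
exact.
Qed.

(** By [Phi_norm_le] an unstable variable is null, so the constant 1 is stable,
    but it grows at least at the rate alpha + beta. *)
Lemma no_dichotomy_high : 1 / 2 < be -> ~ exponential_dichotomy W Phi (al + be).
Proof.
move=> be2 [K [kap [U [S [K0 kap0 dec HS HU]]]]].
have k0 : 0 < 2 * be - 1 by lra.
have K1 : 0 < K^-1 by rewrite invr_gt0.
have U0 Y : U 0 Y -> Y = (fun=> 0) %[ae P].
  move=> UY; have hY : ms_space W 0 Y by have [[sub _ _ _] _ _ _] := dec 0; exact: sub.
  apply: (ms_norm_eq0 hY).
  suff : K^-1 ^+ 2 * ms_norm P Y ^+ 2 <= 0 by rewrite pmulr_rle0// exprn_gt0.
  apply: (@expR_dominates _ (2 * (al + be + kap)) (2 * (al + be)) _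
    ((2 + (2 * be - 1)^-1) * ms_norm P Y ^+ 2)).
    by rewrite ltr_pM2l// ltrDl.
  move=> tau t0; have h1 := HU 0 tau Y t0 UY; have := Phi_norm_le be2 t0 hY.
  rewrite subr0 in h1 *; rewrite mulrAC; apply: le_trans.
  exact: sqr_lower (ltW K1) (ms_norm_ge0 _) h1.
have h1 := ms_space_cst 0 1.
have S1 : S 0 one by exact: direct_sum_null_unstable (dec 0) U0 h1.
have n1 : ms_norm P one ^+ 2 = 1 by rewrite ms_norm_sqr ip11.
have m1 : mean one ^+ 2 = 1 by rewrite mean_cst expr1n.
suff : (1 : R) <= 0 by rewrite leNgt ltr01.
apply: (@expR_dominates _ (2 * (al + be)) (2 * (al + be - kap)) _ (K ^+ 2)).
  by rewrite ltr_pM2l// gtrBl.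
move=> tau t0; have := sqr_upper (ms_norm_ge0 _) (HS 0 tau one t0 S1).
rewrite n1 mulr1 subr0; apply: le_trans.
rewrite (Phi_norm t0 h1) n1 m1 subr0.
have h01 : 0 <= (1 : R) <= 1 by rewrite ler01 lexx.
apply: le_trans (ler_wpM2l (expR_ge0 _) (growth_ge_mean (2 * be - 1) t0 h01)).
by rewrite !mul1r -expRD le_eqVlt; apply/orP; left; apply/eqP; congr expR; field.
Qed.

Lemma dichotomy_below g : g < al + 1 / 2 -> exponential_dichotomy W Phi g.
Proof.
move=> gl; apply: (@dichotomy_of_growth g (1 + `|2 * be - 1|)^-1 (al + 1 / 2)) => //.
by move=> s t X; exact: Phi_norm_ge.
Qed.

(** For beta <= 1/2 the factor 1 + tau of [growth_le_linear] is absorbed by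
    raising the rate half of the way to g. *)
Lemma dichotomy_above g : al + 1 / 2 < g -> (1 / 2 < be -> al + be < g) ->
  exponential_dichotomy W Phi g.
Proof.
move=> lg hbe; have [be2|be2] := ltP (1 / 2) be.
  have k0 : 0 < 2 * be - 1 by lra.
  apply: (@dichotomy_of_decay g (2 + (2 * be - 1)^-1) (al + be)).
  - by rewrite addr_gt0// invr_gt0.
  - exact: hbe.
  - by move=> s t X; exact: Phi_norm_le.
have k0 : 2 * be - 1 <= 0 by lra.
pose del := g - (al + 1 / 2).
have d0 : 0 < del by rewrite subr_gt0.
apply: (@dichotomy_of_decay g (1 + del^-1) (al + 1 / 2 + del / 2)).
- by rewrite addr_gt0// invr_gt0.
- by rewrite /del; lra.
move=> s t X st hX; have ts : 0 <= t - s by rewrite subr_ge0.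
have mn := mean_sqr_le (ms_space_sqint hX); rewrite -ms_norm_sqr in mn.
rewrite (Phi_norm st hX).
apply: le_trans (ler_wpM2l (expR_ge0 _) (growth_le_linear k0 ts mn)) _.
have -> : expR (2 * (al + 1 / 2 + del / 2) * (t - s)) =
  expR (2 * (al + 1 / 2) * (t - s)) * expR (del * (t - s)).
  by rewrite -expRD; congr expR; field.
have h : 1 + (t - s) <= (1 + del^-1) * expR (del * (t - s)).
  apply: le_trans (_ : (1 + del^-1) * (1 + del * (t - s)) <= _); last first.
    by rewrite ler_wpM2l ?expR_ge1Dx// addr_ge0// invr_ge0 ltW.
  have -> : (1 + del^-1) * (1 + del * (t - s)) =
      1 + (t - s) + (del^-1 + del * (t - s)).
    by field; rewrite gt_eqF.
  by rewrite lerDl addr_ge0// ?mulr_ge0// ?invr_ge0 ltW.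
rewrite [leRHS](_ : _ = expR (2 * (al + 1 / 2) * (t - s)) *
  (ms_norm P X ^+ 2 * ((1 + del^-1) * expR (del * (t - s))))); last by ring.
apply: ler_wpM2l; first exact: expR_ge0.
by apply: ler_wpM2l; [exact: sqr_ge0|exact: h].
Qed.

Lemma spectrum_eq : ms_dichotomy_spectrum W Phi =
    if 1 / 2 < be then [set al + 1 / 2] `|` [set al + be]
    else [set al + 1 / 2].
Proof.
apply/seteqP; split => [g nd|g].
  have [gl|lg|->] := ltgtP g (al + 1 / 2).
  - by exfalso; apply: nd; exact: dichotomy_below.
  - case: ifPn => be2 /=; last first.
      by exfalso; apply: nd; apply: dichotomy_above => // /(negP be2).
    right; have [gl2|l2g|//] := ltgtP g (al + be); exfalso; apply: nd.
      exact: dichotomy_between.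
    exact: dichotomy_above.
  - by case: ifP => _ /=; [left|].
case: ifPn => [be2 /= [->|->]|_ /= ->].
- exact: no_dichotomy_low.
- exact: no_dichotomy_high.
- exact: no_dichotomy_low.
Qed.

End dichotomy.

Theorem theorem11 (R : realType) (d : measure_display)
    (Omega : measurableType d) (P : probability Omega R)
    (W : R -> {RV P >-> R}) (alpha beta : R)
    (Phi : R -> R -> (Omega -> R) -> (Omega -> R)) :
  measure_is_complete P ->
  two_sided_wiener W ->
  generated_by_mf_sde W alpha beta Phi ->
  ms_dichotomy_spectrum W Phi =
    if 1 / 2 < beta then [set alpha + 1 / 2] `|` [set alpha + beta]
    else [set alpha + 1 / 2].
Proof. by move=> cP wW genPhi; exact: spectrum_eq. Qed.
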